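(* Let $\rho>0$, let $L$ be a slowly varying function, put $h(p)=p^{\rho}L(p)$ for primes $p$, and let $$F(n)=\sum_{p^{\alpha}\| n}\alpha\,h(p)\qquad(n\ge 1).$$ Then $$\sum_{n\le x}F(n)=\left(\frac{\zeta(\rho+1)}{\rho+1}+o(1)\right)\frac{x^{\rho+1}L(x)}{\log x}\qquad(x\to\infty).$$
   Context: A slowly varying function $L$ is a positive, continuous function (taken here to be defined on $[2,\infty)$, so that $L(p)$ makes sense for every prime $p$) satisfying $\lim_{x\to\infty}L(cx)/L(x)=1$ for every $c>0$. The letter $p$ denotes primes; $p^{\alpha}\|n$ means that $p^{\alpha}$ divides $n$ but $p^{\alpha+1}$ does not, and the sum defining $F(n)$ runs over all prime powers $p^\alpha$ with $\alpha\ge1$ and $p^\alpha\|n$ (so $F(1)=0$). $\zeta$ is the Riemann zeta-function. *)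

(* Defs.v *)
From HB Require Import structures.
From mathcomp Require Export all_boot all_order all_algebra.
From mathcomp Require Export all_classical all_reals all_analysis.

Set Implicit Arguments.
Unset Strict Implicit.
Unset Printing Implicit Defensive.

Import Order.TTheory GRing.Theory Num.Theory.
Import numFieldNormedType.Exports.

Local Open Scope classical_set_scope.
Local Open Scope ring_scope.

(* Only the values of [L] on [2, +oo[ are relevant: the values of the total
   function [L : R -> R] below 2 are unconstrained and never used. *)
Definition slowly_varying (R : realType) (L : R -> R) : Prop :=
  [/\ forall x : R, 2 <= x -> 0 < L x,
      {within `[2, +oo[, continuous L} &
      forall c : R, 0 < c -> L (c * x) / L x @[x --> +oo] --> (1 : R)].

(* The Riemann zeta function at a real argument [s > 1]; the series does not
   converge for other [s], where the value is meaningless. *)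
Definition zeta (R : realType) (s : R) : R :=
  limn (series (fun n : nat => (n.+1%:R `^ s)^-1)).

Definition h (R : realType) (rho : R) (L : R -> R) (p : nat) : R :=
  p%:R `^ rho * L p%:R.

(* p ^ a || n *)
Definition exactly_divides (p a n : nat) : bool :=
  (p ^ a %| n)%N && ~~ (p ^ a.+1 %| n)%N.

(* For n > 0, p ^ a %| n with p prime and 0 < a forces p <= n and a < n.+1, so
   the ranges of summation lose no prime power. *)
Definition F (R : realType) (rho : R) (L : R -> R) (n : nat) : R :=
  \sum_(1 <= p < n.+1 | prime p)
    \sum_(1 <= a < n.+1 | exactly_divides p a n) a%:R * h rho L p.

(* Main.v *)
(** For L = 1 the theorem is equivalent to the prime number theorem by Moebius
    inversion, so the prime number theorem has to be proved; the route is
    elementary (Selberg).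

    Put R(N) = psi(N) - N.  The Tatuzawa-Iseki identity, applied to
    psi(x) - x + gamma + 1, gives R(N) ln N + sum_k Lambda(k) R(N/k) = O(N).
    Inserting this relation into itself and using Selberg's formula for
    Lambda ln + Lambda * Lambda yields
      |R(N)| ln^2 N <= 2 N sum_{m <= N} |R(m)| ln(N/m) / (m (m+1)) + O(N ln N).
    As the sums of R(m) / (m (m+1)) are bounded, R changes sign in every long
    multiplicative window, and it stays small after a sign change because short
    intervals contain few primes.  Hence the logarithmic average of |R(m)| / m is
    smaller, by a fixed amount, than any positive limsup al of |R(m)| / m, and the
    inequality above contradicts the definition of al.

    By Baire's theorem L(cx)/L(x) -> 1 uniformly for c in a compact set.  So, for
    s > 0, the quotient t(y) of sum_{p <= y} p^(s-1) L(p) by y^s L(y) / ln y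
    satisfies t(y) = q^s t(qy) + 1 - q up to small errors; iterating this
    contraction and letting q -> 1 gives t(y) -> 1/s.  Finally the sum of F(n) over
    n <= x is, up to a small error, the sum of sum_{p <= x/m} h(p) over m <= M; the
    primes p <= x/M, which carry all the higher prime powers, contribute little by
    the same estimate for s = rho. *)
Require Import Defs.
From mathcomp Require Import all_boot all_order all_algebra.
From mathcomp Require Import all_classical all_reals all_analysis.
From mathcomp Require Import ring lra zify.
Set Implicit Arguments.
Unset Strict Implicit.
Unset Printing Implicit Defensive.

Import Order.TTheory GRing.Theory Num.Theory.
Import numFieldNormedType.Exports.
Local Open Scope classical_set_scope.
Local Open Scope ring_scope.

(** * Divisor sums *)

(** Taking absolute values at once in R(N) ln N + sum_k Lambda(k) R(N/k) = O(N) leads nowhere: it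
    averages |R| only over the points N/k with k a prime power, and R may be large exactly there.
    After the relation is inserted into itself, the weights Lambda ln and Lambda * Lambda occur with
    opposite signs; absolute values merge them into one weight whose partial sums are known up to
    O(N). The prime powers are thereby traded for a smooth density, and smallness of R on a positive
    proportion of integers counts.

    The shift gamma + 1 comes from sum_{m <= y} psi(y/m) = ln(y!) = y ln y - y + O(ln y) and y
    sum_{m <= y} 1/m = y ln y + gamma y + O(1): it cancels the linear terms and leaves O(ln y),
    small enough to be summed with |mu| <= 1.

    R is sampled at integers, so N/k is integer division and many terms below are mere floor
    corrections. The numerical constants are explicit but not optimised.

    The factor 1/s is the limit as q -> 1 of (1 - q)/(1 - q^s), the fixed point of t = q^s t + 1 -
    q; errors must therefore be o(1 - q). *)

Lemma sum_multiples (V : nmodType) (N d : nat) (f : nat -> V) : (0 < d)%N ->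
  \sum_(1 <= k < N.+1 | (d %| k)%N) f k =
  \sum_(1 <= m < (N %/ d).+1) f (d * m)%N.
Proof.
move=> d0; elim: N => [|N IH]; first by rewrite div0n !big_geq.
rewrite big_mkcond big_nat_recr //= -big_mkcond /= IH divnS //.
case: (boolP (d %| N.+1)%N) => h /=; last by rewrite addr0 add0n.
rewrite add1n [RHS]big_nat_recr //=; congr (_ + f _).
by have := divnK h; rewrite divnS // h add1n mulnC.
Qed.

Lemma sum_dvd_widen (V : nmodType) (k N : nat) (f : nat -> V) :
  (0 < k <= N)%N ->
  \sum_(1 <= d < N.+1 | (d %| k)%N) f d = \sum_(1 <= d < k.+1 | (d %| k)%N) f d.
Proof.
move=> /andP[k0 kN].
rewrite (big_cat_nat (n := k.+1)) //= [X in _ + X]big_nat_cond [X in _ + X]big1 ?addr0 //.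
by move=> i /andP[/andP[h _] /(dvdn_leq k0)]; rewrite leqNgt h.
Qed.

(** The second argument of [f] is the product, so that the pairs can be grouped by k = n m. *)
Lemma sum_hyperbola (V : nmodType) (N : nat) (f : nat -> nat -> V) :
  \sum_(1 <= n < N.+1) \sum_(1 <= m < (N %/ n).+1) f n (n * m)%N =
  \sum_(1 <= k < N.+1) \sum_(1 <= d < k.+1 | (d %| k)%N) f d k.
Proof.
transitivity (\sum_(1 <= n < N.+1) \sum_(1 <= k < N.+1 | (n %| k)%N) f n k).
  rewrite big_nat [RHS]big_nat; apply: eq_bigr => n /andP[n0 _].
  by rewrite sum_multiples.
rewrite (exchange_big_dep_nat xpredT) //= [LHS]big_nat [RHS]big_nat.
by apply: eq_bigr => k hk; rewrite sum_dvd_widen.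
Qed.

Lemma sum_nat_const_le (V : nmodType) (N v : nat) (c : V) : (v <= N)%N ->
  \sum_(1 <= a < N.+1 | (a <= v)%N) c = c *+ v.
Proof.
move=> vN; rewrite (big_cat_nat (n := v.+1)) //=.
rewrite [X in _ + X]big_nat_cond [X in _ + X]big1 ?addr0; last first.
  by move=> i /andP[/andP[h _]]; rewrite leqNgt h.
rewrite big_nat_cond (eq_bigl (fun a => (1 <= a < v.+1)%N)) -?big_nat.
  by rewrite sumr_const_nat subn1.
by move=> i /=; rewrite ltnS; case: (0 < i)%N => //=; rewrite andbb.
Qed.

(** The condition on the right is symmetric in d and e, which gives associativity of Dirichlet
    convolution in [sum_mobius_ln]. *)
Lemma sum_dvd_exchange (V : nmodType) (k : nat) (f : nat -> nat -> V) :
  (0 < k)%N ->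
  \sum_(1 <= d < k.+1 | (d %| k)%N) \sum_(1 <= e < (k %/ d).+1 | (e %| k %/ d)%N) f d e =
  \sum_(1 <= d < k.+1) \sum_(1 <= e < k.+1 | (d * e %| k)%N) f d e.
Proof.
move=> k0; rewrite big_mkcond big_nat [RHS]big_nat; apply: eq_bigr => d /andP[d0 _].
case: ifPn => dk.
  rewrite -(sum_dvd_widen (N := k)); last first.
    by rewrite divn_gt0 // dvdn_leq //= leq_div.
  by apply: eq_bigl => e; rewrite dvdn_divRL // mulnC.
by rewrite big1 // => e h; case/negP: dk; apply: dvdn_trans h; rewrite dvdn_mulr.
Qed.

Lemma ln_prod_nat (R : realType) (N : nat) (P : pred nat) (f : nat -> nat) :
  (forall i, (0 < f i)%N) ->
  ln (\prod_(0 <= i < N | P i) f i)%:R = \sum_(0 <= i < N | P i) ln (f i)%:R :> R.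
Proof.
move=> f0.
(* Positivity of the partial products is carried along because [lnM] asks for it. *)
have H : (0 < \prod_(0 <= i < N | P i) f i)%N /\
  ln (\prod_(0 <= i < N | P i) f i)%:R = \sum_(0 <= i < N | P i) ln (f i)%:R :> R.
  elim: {N}(index_iota 0 N) => [|i s [x0 E]]; first by rewrite !big_nil ln1.
  rewrite !big_cons; case: ifP => // _; split; first by rewrite muln_gt0 f0.
  by rewrite natrM lnM ?posrE ?ltr0n ?E.
by case: H.
Qed.

Lemma ln_logn (R : realType) (n : nat) : (0 < n)%N ->
  ln n%:R = \sum_(1 <= p < n.+1 | prime p) ln p%:R *+ logn p n :> R.
Proof.
move=> n0; rewrite -[in LHS](partnT n0) ln_prod_nat; last first.
  by move=> p; rewrite expn_gt0; case: p => //=; rewrite lognE.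
rewrite big_ltn // lognE /= expn0 ln1 add0r [RHS]big_mkcond.
rewrite big_nat_cond [RHS]big_nat_cond; apply: eq_big => [p|p _]; first by rewrite andbT.
case: ifPn => pp; last by rewrite lognE (negbTE pp) /= expn0 ln1.
by rewrite natrX lnXn ?ltr0n ?prime_gt0.
Qed.

(** At most one pair (p, a) contributes. The double sum avoids extracting the prime from n and can
    be exchanged with other sums. *)
Definition vonMangoldt (R : realType) (n : nat) : R :=
  \sum_(1 <= p < n.+1 | prime p) \sum_(1 <= a < n.+1 | (p ^ a == n)%N) ln p%:R.

Lemma ln_nat_ge0 (R : realType) (n : nat) : 0 <= ln n%:R :> R.
Proof.
by case: n => [|n]; [rewrite ln0 | rewrite ln_ge0 // ler1n].
Qed.

Lemma vonMangoldt_ge0 (R : realType) (n : nat) : 0 <= vonMangoldt R n.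
Proof. by apply: sumr_ge0 => p _; apply: sumr_ge0 => a _; exact: ln_nat_ge0. Qed.

(** Ranges that do not depend on n make the exchange of summations possible; p^a = n forces p <= n
    and a < n. *)
Lemma vonMangoldt_widen (R : realType) (n N : nat) : (0 < n <= N)%N ->
  vonMangoldt R n =
  \sum_(1 <= p < N.+1 | prime p) \sum_(1 <= a < N.+1 | (p ^ a == n)%N) ln p%:R.
Proof.
move=> /andP[n0 nN]; rewrite [RHS](big_cat_nat (n := n.+1)) //=.
rewrite [X in _ + X]big_nat_cond [X in _ + X]big1 ?addr0; last first.
  move=> p /andP[/andP[h _] pp]; rewrite big_nat_cond big1 // => a /andP[/andP[a0 _] /eqP E].
  move: h; rewrite -E ltnNge; case: a a0 E => // a _ _.
  by rewrite expnS leq_pmulr // expn_gt0 prime_gt0.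
rewrite [LHS]big_nat_cond [RHS]big_nat_cond.
apply: eq_bigr => p /andP[_ pp].
rewrite [RHS](big_cat_nat (n := n.+1)) //= [X in _ + X]big_nat_cond [X in _ + X]big1 ?addr0 //.
move=> a /andP[/andP[h _] /eqP E]; move: h; rewrite -E ltnNge ltnW //.
by rewrite ltn_expl // prime_gt1.
Qed.

Lemma sum_vonMangoldt_dvd (R : realType) (n : nat) : (0 < n)%N ->
  \sum_(1 <= d < n.+1 | (d %| n)%N) vonMangoldt R d = ln n%:R.
Proof.
move=> n0.
transitivity (\sum_(1 <= d < n.+1 | (d %| n)%N)
  \sum_(1 <= p < n.+1 | prime p) \sum_(1 <= a < n.+1 | (p ^ a == d)%N) (ln p%:R : R)).
  rewrite big_nat_cond [RHS]big_nat_cond.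
  apply: eq_bigr => d /andP[/andP[d0 dn] _]; apply: vonMangoldt_widen.
  by rewrite d0 -ltnS.
rewrite (exchange_big_dep_nat (fun p => prime p)) //= ln_logn //.
rewrite big_nat_cond [RHS]big_nat_cond; apply: eq_bigr => p /andP[_ pp].
rewrite (exchange_big_dep_nat xpredT) //=.
rewrite -(@sum_nat_const_le _ n (logn p n)); last first.
  by rewrite (leq_trans (ltnW (ltn_expl _ (prime_gt1 pp)))) // dvdn_leq // pfactor_dvdnn.
rewrite [RHS]big_mkcond /=; rewrite big_nat [RHS]big_nat; apply: eq_bigr => a /andP[a0 an].
(* For fixed p and a the only candidate is d = p^a, so the sum over p and a counts the exponents a
   <= [logn p n]. *)
rewrite -pfactor_dvdn //; case: ifPn => h.
  rewrite (big_rem (p ^ a)%N) /=; last by rewrite mem_index_iota expn_gt0 prime_gt0 //= ltnS dvdn_leq.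
  rewrite h pp eqxx /= big_seq_cond big1 ?addr0 // => i /andP[].
  by rewrite mem_rem_uniq ?iota_uniq // inE eq_sym => /andP[/negbTE ->]; rewrite andbF.
by rewrite big1 // => i /andP[/andP[hi _] /eqP E]; rewrite E hi in h.
Qed.

(** * The Moebius function *)

Definition mobius (R : realType) (n : nat) : R :=
  if all (fun p => logn p n == 1%N) (primes n) then (-1) ^+ size (primes n)
  else 0.

Lemma mobius1 (R : realType) : mobius R 1 = 1.
Proof. by []. Qed.

Lemma normr_mobius_le1 (R : realType) (n : nat) : `|mobius R n| <= 1.
Proof.
by rewrite /mobius; case: ifP => _; rewrite ?normr0 ?ler01 // normrX normrN1 expr1n.
Qed.

Lemma mobius_prime_mul (R : realType) (p e : nat) :
  prime p -> (0 < e)%N -> ~~ (p %| e)%N -> mobius R (p * e) = - mobius R e.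
Proof.
move=> pp e0 pe; have p0 := prime_gt0 pp.
have P : perm_eq (primes (p * e)) (p :: primes e).
  apply: uniq_perm; rewrite ?primes_uniq //= ?primes_uniq ?andbT.
    by rewrite mem_primes pp e0 (negbTE pe).
  by move=> q; rewrite primesM // primes_prime // !inE.
rewrite /mobius (perm_all _ P) (perm_size P) /=.
rewrite lognM // logn_prime // eqxx.
rewrite (_ : logn p e = 0%N); last first.
  by apply/eqP; rewrite -leqn0 leqNgt -pfactor_dvdn // expn1.
rewrite addn0 eqxx /=.
rewrite (_ : all _ (primes e) = all (fun q => logn q e == 1%N) (primes e)).
  by case: ifP => _; rewrite ?oppr0 // exprS mulN1r.
apply: eq_in_all => q; rewrite mem_primes => /and3P[qq _ qe].
rewrite lognM // logn_prime //.
case: (q =P p) => [E|qp]; last by [].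
by rewrite -E qe in pe.
Qed.

Lemma mobius_sqr_mul (R : realType) (p e : nat) :
  prime p -> (0 < e)%N -> (p %| e)%N -> mobius R (p * e) = 0.
Proof.
move=> pp e0 pe; have p0 := prime_gt0 pp.
rewrite /mobius; case: allP => // /(_ p); rewrite mem_primes pp muln_gt0 p0 e0 dvdn_mulr //.
move=> /(_ isT); rewrite lognM // logn_prime // eqxx.
have : (0 < logn p e)%N by rewrite -pfactor_dvdn // expn1.
by case: (logn p e).
Qed.

(** With p the least prime factor of n, the divisors e prime to p cancel against the divisors p e;
    divisors p e with p dividing e contribute 0. *)
Lemma sum_mobius_dvd (R : realType) (n : nat) : (0 < n)%N ->
  \sum_(1 <= d < n.+1 | (d %| n)%N) mobius R d = (n == 1%N)%:R.
Proof.
move=> n0; case: (eqVneq n 1%N) => [->|n1].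
  by rewrite big_mkcond big_nat1.
have pp : prime (pdiv n) by rewrite pdiv_prime // ltn_neqAle eq_sym n1.
have p0 := prime_gt0 pp; set p := pdiv n in pp p0 *.
have pn : (p %| n)%N by rewrite pdiv_dvd.
set m := (n %/ p)%N; have En : n = (p * m)%N by rewrite mulnC divnK.
have m0 : (0 < m)%N by rewrite divn_gt0 // dvdn_leq.
rewrite (bigID (fun d => (p %| d)%N)) /=.
rewrite (eq_bigl (fun d => (p %| d)%N && (d %| n)%N)); last by move=> d; rewrite andbC.
rewrite big_mkcondr sum_multiples // -big_mkcond /= -/m.
have -> : \sum_(1 <= e < m.+1 | (p * e %| n)%N) mobius R (p * e) =
          - \sum_(1 <= e < m.+1 | (e %| m)%N && ~~ (p %| e)%N) mobius R e.
  rewrite -sumrN [RHS]big_mkcondr [LHS]big_nat_cond [RHS]big_nat_cond.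
  apply: eq_big => [e|e]; first by rewrite En dvdn_pmul2l.
  move=> /andP[/andP[e0 _] _]; case: ifPn => pe; first by rewrite mobius_prime_mul.
  by rewrite mobius_sqr_mul //; apply: contraNT pe.
rewrite addrC; apply/eqP; rewrite subr_eq0; apply/eqP.
rewrite [LHS](big_cat_nat (n := m.+1)) //=; last by rewrite ltnS leq_div.
rewrite [X in _ + X]big_nat_cond [X in _ + X]big1 ?addr0 => [|i]; last first.
  move=> /andP[/andP[h _] /andP[h2 h3]]; move: h; rewrite ltnNge dvdn_leq //.
  by move: h2; rewrite En Gauss_dvdr // coprime_sym prime_coprime.
apply: eq_bigl => d; case: (boolP (p %| d)%N); rewrite ?andbF // !andbT => h3.
by rewrite En Gauss_dvdr // coprime_sym prime_coprime.
Qed.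

(** Moebius inversion of [sum_vonMangoldt_dvd] gives Lambda(k) = sum mu(d) ln(k/d). On writing
    ln(k/d) = ln k - ln d, the ln k part vanishes: the sum of mu(d) is 0 unless k = 1, and then ln k
    = 0. *)
Lemma sum_mobius_ln (R : realType) (k : nat) : (0 < k)%N ->
  \sum_(1 <= d < k.+1 | (d %| k)%N) mobius R d * ln d%:R = - vonMangoldt R k.
Proof.
move=> k0.
have E : \sum_(1 <= d < k.+1 | (d %| k)%N) mobius R d * ln (k %/ d)%:R = vonMangoldt R k.
  transitivity (\sum_(1 <= d < k.+1 | (d %| k)%N)
    \sum_(1 <= e < (k %/ d).+1 | (e %| k %/ d)%N) mobius R d * vonMangoldt R e).
    rewrite big_nat_cond [RHS]big_nat_cond; apply: eq_bigr => d /andP[/andP[d0 _] dk].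
    by rewrite -mulr_sumr sum_vonMangoldt_dvd // divn_gt0 // dvdn_leq.
  (* With e outermost, the inner sum of mu over the divisors of k/e leaves only e = k. *)
  rewrite sum_dvd_exchange // (exchange_big_dep_nat xpredT) //=.
  transitivity (\sum_(1 <= e < k.+1) \sum_(1 <= d < k.+1 | (e * d %| k)%N)
    mobius R d * vonMangoldt R e).
    by apply: eq_bigr => e _; apply: eq_bigl => d; rewrite mulnC.
  rewrite -sum_dvd_exchange // big_mkcond big_nat_recr //= dvdnn divnn k0.
  rewrite [X in _ + X]big_mkcond big_nat1 /= mobius1 mul1r big_nat big1 ?add0r // => e /andP[e0 ek].
  case: ifP => // h; rewrite -mulr_suml sum_mobius_dvd ?divn_gt0 1?dvdn_leq //.
  case: eqP => [E|]; last by rewrite mul0r.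
  by have := divnK h; rewrite E mul1n => E2; rewrite E2 ltnn in ek.
rewrite -E big_nat_cond [in RHS]big_nat_cond.
have -> : \sum_(1 <= i < k.+1 | (0 < i < k.+1)%N && (i %| k)%N) mobius R i * ln (k %/ i)%:R
  = \sum_(1 <= i < k.+1 | (0 < i < k.+1)%N && (i %| k)%N)
      (mobius R i * ln k%:R - mobius R i * ln i%:R).
  apply: eq_bigr => d /andP[/andP[d0 _] dk]; rewrite -mulrBr; congr (_ * _).
  rewrite -[in RHS](divnK dk) natrM lnM ?addrK // posrE ltr0n ?divn_gt0 //.
  by rewrite dvdn_leq.
rewrite sumrB -!big_nat_cond -mulr_suml sum_mobius_dvd //.
case: eqP => [->|_]; first by rewrite ln1 mulr0 sub0r opprK.
by rewrite mul0r sub0r opprK.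
Qed.

Lemma sum_hyperbola_cond (V : nmodType) (N : nat) (g : nat -> nat -> V) :
  \sum_(1 <= n < N.+1) \sum_(1 <= m < (N %/ n).+1) g n m =
  \sum_(1 <= n < N.+1) \sum_(1 <= m < N.+1 | (n * m <= N)%N) g n m.
Proof.
rewrite big_nat [RHS]big_nat; apply: eq_bigr => n /andP[n0 nN].
rewrite [RHS](big_cat_nat (n := (N %/ n).+1)) //=; last by rewrite ltnS leq_div.
rewrite [X in _ + X]big_nat_cond [X in _ + X]big1 ?addr0 => [|i]; last first.
  by move=> /andP[/andP[h _] h2]; move: h; rewrite ltnNge leq_divRL // mulnC h2.
rewrite big_nat [RHS]big_nat_cond; apply: eq_bigl => m.
by case: (boolP (0 < m < _)%N) => //= /andP[_]; rewrite ltnS leq_divRL // mulnC => ->.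
Qed.

Lemma sum_hyperbola_sym (V : nmodType) (N : nat) (g : nat -> nat -> V) :
  \sum_(1 <= n < N.+1) \sum_(1 <= m < (N %/ n).+1) g n m =
  \sum_(1 <= m < N.+1) \sum_(1 <= n < (N %/ m).+1) g n m.
Proof.
rewrite sum_hyperbola_cond [RHS]sum_hyperbola_cond (exchange_big_dep_nat xpredT) //=.
by apply: eq_bigr => m _; apply: eq_bigl => n; rewrite mulnC.
Qed.

(** * Chebyshev and Mertens estimates *)

Lemma ln_le_subr1 (R : realType) (x : R) : 0 < x -> ln x <= x - 1.
Proof.
move=> x0; have := @le_ln1Dx R (x - 1).
by rewrite (addrC 1) subrK; apply; rewrite ltrBrDl subrr.
Qed.

Lemma ln_ge_1Binv (R : realType) (x : R) : 0 < x -> 1 - x^-1 <= ln x.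
Proof.
move=> x0; have := @ln_le_subr1 R x^-1; rewrite invr_gt0 lnV ?posrE // => /(_ x0).
by rewrite lerNl opprB.
Qed.

Lemma ln_natS_ub (R : realType) (n : nat) : (0 < n)%N ->
  ln n.+1%:R - ln n%:R <= n%:R^-1 :> R.
Proof.
move=> n0; rewrite -ln_div ?posrE ?ltr0n //.
apply: (le_trans (ln_le_subr1 _)); first by rewrite divr_gt0 ?ltr0n.
by rewrite -natr1 mulrDl divff ?pnatr_eq0 -?lt0n // mul1r addrC addKr.
Qed.

Lemma ln_natS_lb (R : realType) (n : nat) : (0 < n)%N ->
  n.+1%:R^-1 <= ln n.+1%:R - ln n%:R :> R.
Proof.
move=> n0; rewrite -ln_div ?posrE ?ltr0n //.
apply: le_trans (ln_ge_1Binv _); last by rewrite divr_gt0 ?ltr0n.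
rewrite invf_div -[X in X - _](@divff _ n.+1%:R) ?pnatr_eq0 // -mulrBl.
by rewrite -[in X in X - _]natr1 [X in X - _]addrC addrK mul1r.
Qed.

Lemma sum_ln_lb (R : realType) (N : nat) :
  N%:R * ln N%:R - N%:R <= \sum_(1 <= k < N.+1) ln k%:R :> R.
Proof.
elim: N => [|[|N] IH]; first by rewrite big_geq // mul0r subr0.
  by rewrite big_nat1 ln1 mulr0 sub0r lerN10.
rewrite big_nat_recr //=; set x : R := N.+1%:R in IH *.
have x0 : 0 < x by rewrite ltr0n.
have := @ln_natS_ub R N.+1 isT; rewrite -/x => h.
have h2 : x * (ln N.+2%:R - ln x) <= 1.
  by rewrite (le_trans (ler_wpM2l (ltW x0) h)) // divff // gt_eqF.
have E : N.+2%:R = x + 1 by rewrite natr1.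
move: IH h2; set S := \sum_(_ <= _ < _) _; set a := ln x; set b := ln N.+2%:R; rewrite E.
by lra.
Qed.

Lemma sum_ln_ub (R : realType) (N : nat) : (0 < N)%N ->
  \sum_(1 <= k < N.+1) ln k%:R <= N%:R * ln N%:R - N%:R + ln N%:R + 1 :> R.
Proof.
elim: N => [//|[|N] IH] _; first by rewrite big_nat1 ln1 mulr0 sub0r addr0 addNr.
rewrite big_nat_recr //=; have := IH isT; set x : R := N.+1%:R => {}IH.
have := @ln_natS_lb R N.+1 isT; rewrite -/x.
have E : N.+2%:R = x + 1 by rewrite natr1.
have y0 : 0 < x + 1 by rewrite -E ltr0n.
set b := ln N.+2%:R; rewrite E => h.
have h2 : 1 <= (x + 1) * (b - ln x).
  by rewrite (le_trans _ (ler_wpM2l (ltW y0) h)) // divff // gt_eqF.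
move: IH h2; set S := \sum_(_ <= _ < _) _; set a := ln x.
by lra.
Qed.

(** H_N - ln N decreases, H_N - ln N - 1/N increases, and they enclose g, the supremum of the
    latter. The index of [u] and [v] is N - 1. *)
Lemma euler_constant (R : realType) : exists g : R,
  forall N, (0 < N)%N ->
    g <= \sum_(1 <= k < N.+1) k%:R^-1 - ln N%:R <= g + N%:R^-1.
Proof.
pose H N : R := \sum_(1 <= k < N.+1) k%:R^-1.
have HS N : H N.+1 = H N + N.+1%:R^-1 by rewrite /H big_nat_recr.
pose u N := H N.+1 - ln N.+1%:R; pose v N := u N - N.+1%:R^-1.
have ud : nonincreasing_seq u.
  apply/nonincreasing_seqP => n; rewrite /u HS.
  have := @ln_natS_lb R n.+1 isT.
  by move: (ln n.+2%:R : R) (ln n.+1%:R : R) (n.+2%:R^-1 : R) (n.+1%:R^-1 : R) (H n.+1) => *; lra.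
have vi : nondecreasing_seq v.
  apply/nondecreasing_seqP => n; rewrite /v /u (HS n.+1).
  have := @ln_natS_ub R n.+1 isT.
  by move: (ln n.+2%:R : R) (ln n.+1%:R : R) (n.+2%:R^-1 : R) (n.+1%:R^-1 : R) (H n.+1) => *; lra.
have vu n m : v n <= u m.
  apply: (@le_trans _ _ (v (maxn n m))); first by apply: vi; rewrite leq_maxl.
  apply: (@le_trans _ _ (u (maxn n m))); last by apply: ud; rewrite leq_maxr.
  by rewrite /v gerBl invr_ge0.
exists (sup (range v)) => -[//|N] _; rewrite -/(H N.+1) -/(u N); apply/andP; split.
  apply: ge_sup; first by exists (v 0%N), 0%N.
  by move=> _ [n _ <-].
rewrite -lerBlDr; apply: ub_le_sup; last by exists N.
by exists (u 0%N) => _ [n _ <-].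
Qed.

Definition psi (R : realType) (N : nat) : R := \sum_(1 <= n < N.+1) vonMangoldt R n.

Lemma psi_ge0 (R : realType) (N : nat) : 0 <= psi R N.
Proof. by apply: sumr_ge0 => n _; exact: vonMangoldt_ge0. Qed.

Lemma psiS (R : realType) (N : nat) : psi R N.+1 = psi R N + vonMangoldt R N.+1.
Proof. by rewrite /psi big_nat_recr. Qed.

Lemma sum_ln_vonMangoldt (R : realType) (N : nat) :
  \sum_(1 <= k < N.+1) ln k%:R =
  \sum_(1 <= d < N.+1) vonMangoldt R d * (N %/ d)%:R.
Proof.
transitivity (\sum_(1 <= k < N.+1) \sum_(1 <= d < k.+1 | (d %| k)%N) vonMangoldt R d).
  by rewrite big_nat [RHS]big_nat; apply: eq_bigr => k /andP[k0 _]; rewrite sum_vonMangoldt_dvd.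
rewrite -(sum_hyperbola _ (fun d k => vonMangoldt R d)).
by apply: eq_bigr => d _; rewrite sumr_const_nat subn1 mulr_natr.
Qed.

Lemma sum_ln_psi (R : realType) (N : nat) :
  \sum_(1 <= k < N.+1) ln k%:R = \sum_(1 <= m < N.+1) psi R (N %/ m).
Proof.
rewrite sum_ln_vonMangoldt -(sum_hyperbola_sym _ (fun n m => vonMangoldt R n)).
by apply: eq_bigr => d _; rewrite sumr_const_nat subn1 mulr_natr.
Qed.

(** Chebyshev's argument: Lambda(d) occurs on the right with coefficient [N/d] - 2 [[N/2]/d], which
    is nonnegative, and at least 1 for N/2 < d <= N. *)
Lemma psi_half (R : realType) (N : nat) :
  psi R N - psi R (N %/ 2) <=
  \sum_(1 <= k < N.+1) ln k%:R - 2 * \sum_(1 <= k < (N %/ 2).+1) ln k%:R.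
Proof.
have hN : (N %/ 2 <= N)%N by rewrite leq_div.
have extend : \sum_(1 <= k < (N %/ 2).+1) (ln k%:R : R) =
    \sum_(1 <= d < N.+1) vonMangoldt R d * (N %/ 2 %/ d)%:R.
  rewrite sum_ln_vonMangoldt [RHS](big_cat_nat (n := (N %/ 2).+1)) //=.
  rewrite [X in _ + X]big_nat [X in _ + X]big1 ?addr0 // => i /andP[h _].
  by rewrite divn_small // mulr0.
rewrite extend sum_ln_vonMangoldt mulr_sumr -sumrB /psi.
rewrite [X in X - _](big_cat_nat (n := (N %/ 2).+1)) //= [X in X - _]addrC addrK.
rewrite [leRHS](big_cat_nat (n := (N %/ 2).+1)) //=.
rewrite -[leLHS]add0r lerD //.
  rewrite big_nat; apply: sumr_ge0 => d /andP[d0 _].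
  rewrite mulrCA -mulrBr mulr_ge0 ?vonMangoldt_ge0 // subr_ge0 -natrM ler_nat.
  rewrite leq_divRL // -mulnA mulnC -leq_divRL // -divnMA mulnC.
  by rewrite divnMA mulnC leq_trunc_div.
rewrite big_nat [leRHS]big_nat; apply: ler_sum => d /andP[d1 d2].
rewrite [(N %/ 2 %/ d)%N]divn_small // !mulr0 subr0 ler_peMr ?vonMangoldt_ge0 //.
by rewrite ler1n divn_gt0 //; exact: leq_ltn_trans d1.
Qed.

(** Strong induction by halving: with m = [M/2], [psi_half] and the Stirling bounds give psi(M) -
    psi(m) <= 6 m + 3, and 11 m + 6 m + 3 <= 22 m. *)
Lemma psi_le (R : realType) (N : nat) : psi R N <= 11 * N%:R.
Proof.
have [n] := ubnP N; elim: n N => // n IH [|[|N]] Nn.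
- by rewrite /psi big_geq // mulr0.
- rewrite /psi big_nat1 /vonMangoldt big_mkcond big_nat1 /=.
  by rewrite mulr1.
set M := N.+2; set m := (M %/ 2)%N.
have mM : (m < M)%N by rewrite ltn_Pdiv.
have m1 : (1 <= m)%N by rewrite divn_gt0.
have Ea : (m * 2 <= M <= m * 2 + 1)%N by rewrite /m; lia.
have := psi_half R M; rewrite -/m.
have := @sum_ln_ub R M isT; have := @sum_ln_lb R m.
have := IH m (leq_trans mM Nn).
set x := psi R M; set y := psi R m; set s := \sum_(_ <= _ < _) _; set t := \sum_(_ <= _ < _) _.
have m1R : 1 <= m%:R :> R by rewrite ler1n.
have MR : m%:R * 2 <= M%:R :> R by rewrite -natrM ler_nat; case/andP: Ea.
have MR2 : M%:R <= m%:R * 2 + 1 :> R by rewrite -natrM natr1 ler_nat; case/andP: Ea; lia.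
have lm : ln m%:R <= m%:R - 1 :> R by apply: ln_le_subr1; rewrite ltr0n.
have lm0 := ln_nat_ge0 R m.
have lM : ln M%:R <= ln m%:R + 2 :> R.
  have : ln (M%:R / m%:R : R) <= M%:R / m%:R - 1 by apply: ln_le_subr1; rewrite divr_gt0 ?ltr0n.
  rewrite ln_div ?posrE ?ltr0n // => h.
  have : M%:R / m%:R <= 3 :> R by rewrite ler_pdivrMr ?ltr0n //; lra.
  lra.
have lM2 : M%:R * ln M%:R <= (m%:R * 2 + 1) * (ln m%:R + 2) :> R.
  by apply: ler_pM => //; rewrite ?ler0n ?ln_nat_ge0.
move: (m%:R : R) (M%:R : R) (ln m%:R : R) (ln M%:R : R) m1R MR MR2 lm lm0 lM lM2 => a b c d.
move=> *; nra.
Qed.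

Lemma natr_divn_le (R : realType) (N d : nat) : (N %/ d)%:R <= N%:R / d%:R :> R.
Proof.
case: d => [|d]; first by rewrite divn0 invr0 mulr0.
by rewrite ler_pdivlMr ?ltr0n // -natrM ler_nat leq_trunc_div.
Qed.

Lemma natr_divn_ge (R : realType) (N d : nat) : (0 < d)%N ->
  N%:R / d%:R <= (N %/ d)%:R + 1 :> R.
Proof.
move=> d0; rewrite ler_pdivrMr ?ltr0n // natr1 -natrM ler_nat.
by rewrite ltnW // ltn_ceil.
Qed.

Lemma ln_nat_le (R : realType) (N : nat) : ln N%:R <= N%:R :> R.
Proof.
case: N => [|N]; first by rewrite ln0.
by rewrite (le_trans (ln_le_subr1 _)) ?ltr0n // gerBl.
Qed.

Lemma sum_vonMangoldt_inv_lb (R : realType) (N : nat) : (0 < N)%N ->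
  ln N%:R - 1 <= \sum_(1 <= d < N.+1) vonMangoldt R d / d%:R.
Proof.
move=> N0; have NR : 0 < N%:R :> R by rewrite ltr0n.
rewrite -(ler_pM2l NR) mulrBr mulr1 (le_trans (sum_ln_lb _ _)) //.
rewrite sum_ln_vonMangoldt mulr_sumr; apply: ler_sum => d _.
by rewrite mulrCA ler_wpM2l ?vonMangoldt_ge0 // natr_divn_le.
Qed.

(** Replacing N/d by [N/d] costs at most psi(N) <= 11 N, hence the constant. *)
Lemma sum_vonMangoldt_inv_ub (R : realType) (N : nat) : (0 < N)%N ->
  \sum_(1 <= d < N.+1) vonMangoldt R d / d%:R <= ln N%:R + 11.
Proof.
move=> N0; have NR : 0 < N%:R :> R by rewrite ltr0n.
rewrite -(ler_pM2l NR) mulr_sumr.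
have h : \sum_(1 <= i < N.+1) N%:R * (vonMangoldt R i / i%:R) <=
   \sum_(1 <= d < N.+1) vonMangoldt R d * (N %/ d)%:R + psi R N.
  rewrite -big_split /= big_nat [leRHS]big_nat; apply: ler_sum => d /andP[d0 _].
  by rewrite mulrCA -{3}[vonMangoldt R d]mulr1 -mulrDr ler_wpM2l ?vonMangoldt_ge0 // natr_divn_ge.
apply: (le_trans h); rewrite -sum_ln_vonMangoldt.
have := @sum_ln_ub R N N0; have := psi_le R N.
have : ln N%:R <= N%:R - 1 :> R by apply: ln_le_subr1.
by move: (\sum_(_ <= _ < _) _) (psi R N) (ln N%:R : R) (N%:R : R) => *; nra.
Qed.

(** * Selberg's formula *)

(** Here [f k] stands for a function evaluated at N/k. After grouping by k = n m its coefficient is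
    the sum of mu(d) (ln N - ln d) over d dividing k, known from the two Moebius sums. *)
Lemma tatuzawa_iseki (R : realType) (N : nat) (f : nat -> R) : (0 < N)%N ->
  \sum_(1 <= n < N.+1) mobius R n * (ln N%:R - ln n%:R) *
     \sum_(1 <= m < (N %/ n).+1) f (n * m)%N =
  ln N%:R * f 1%N + \sum_(1 <= k < N.+1) vonMangoldt R k * f k.
Proof.
move=> N0.
transitivity (\sum_(1 <= n < N.+1) \sum_(1 <= m < (N %/ n).+1)
   (fun n k => mobius R n * (ln N%:R - ln n%:R) * f k) n (n * m)%N).
  by apply: eq_bigr => n _; rewrite mulr_sumr.
rewrite (sum_hyperbola N (fun n k => mobius R n * (ln N%:R - ln n%:R) * f k)).
transitivity (\sum_(1 <= k < N.+1) ((k == 1%N)%:R * ln N%:R + vonMangoldt R k) * f k).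
  rewrite big_nat [RHS]big_nat; apply: eq_bigr => k /andP[k0 _].
  rewrite -mulr_suml; congr (_ * _).
  rewrite -(sum_mobius_dvd _ k0) mulr_suml -[vonMangoldt R k]opprK -(sum_mobius_ln _ k0) -sumrB.
  by apply: eq_bigr => d _; rewrite mulrBr.
under eq_bigr do rewrite mulrDl; rewrite big_split /=; congr (_ + _).
rewrite big_nat_recl // eqxx mul1r big_nat big1 ?addr0 // => i /andP[i0 _].
by case: i i0 => // i _; rewrite !mul0r.
Qed.

(** Passing from N to N + 1 with d = ln(N + 1) - ln N adds 2 d sum ln(N/n) + N d^2. Since sum
    ln(N/n) <= N and N d <= 1, this is at most 3. *)
Lemma sum_sqr_ln_le (R : realType) (N : nat) :
  \sum_(1 <= n < N.+1) (ln N%:R - ln n%:R) ^+ 2 <= 3 * N%:R :> R.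
Proof.
elim: N => [|[|N] IH]; first by rewrite big_geq // mulr0.
  by rewrite big_nat1 subrr expr0n mulr1.
rewrite big_nat_recr //= subrr expr0n addr0.
have := @ln_natS_ub R N.+1 isT; have := @ln_natS_lb R N.+1 isT.
set d := ln N.+2%:R - ln N.+1%:R => d0 d1.
have -> : \sum_(1 <= i < N.+2) (ln N.+2%:R - ln i%:R) ^+ 2 =
  \sum_(1 <= i < N.+2) (ln N.+1%:R - ln i%:R) ^+ 2 +
  2 * d * \sum_(1 <= i < N.+2) (ln N.+1%:R - ln i%:R) + N.+1%:R * d ^+ 2 :> R.
  have -> : N.+1%:R * d ^+ 2 = \sum_(1 <= i < N.+2) d ^+ 2.
    by rewrite sumr_const_nat subn1 mulr_natl.
  rewrite mulr_sumr -!big_split /=; apply: eq_bigr => i _.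
  by rewrite /d; move: (ln _) (ln _) (ln _) => a b c; ring.
have -> : \sum_(1 <= i < N.+2) (ln N.+1%:R - ln i%:R) =
   N.+1%:R * ln N.+1%:R - \sum_(1 <= i < N.+2) ln i%:R :> R.
  by rewrite sumrB sumr_const_nat subn1 mulr_natl.
have h := sum_ln_lb R N.+1.
have N1 : 1 <= N.+1%:R :> R by rewrite ler1n.
have E : N.+2%:R = N.+1%:R + 1 :> R by rewrite natr1.
have d0' : 0 <= d by rewrite (le_trans _ d0) // invr_ge0.
have d2 : N.+1%:R * d <= 1.
  by rewrite (le_trans (ler_wpM2l _ d1)) // divff // pnatr_eq0.
move: IH h N1 d2; rewrite E; clear d0 d1 E.
move: (N.+1%:R : R) (ln N.+1%:R : R) (\sum_(_ <= _ < _) _)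
  (\sum_(1 <= i < N.+2) (ln N.+1%:R - ln i%:R : R) ^+ 2) d d0' => x l T S {}d d0 IH h N1 d2.
have : d * (x * l - T) <= d * x by rewrite ler_wpM2l //; lra.
have : x * d ^+ 2 <= 1.
  have := ler_pM (mulr_ge0 (le_trans ler01 N1) d0) d0 d2 (_ : d <= 1).
  rewrite mulr1 -mulrA -expr2; apply.
  by rewrite (le_trans _ d2) // ler_peMl.
nra.
Qed.

Definition psi_err (R : realType) (N : nat) : R := psi R N - N%:R.

(** [g] is Euler's constant; the summand is psi(x) - x + g + 1 at x = N/(n m), and the linear terms
    cancel as in the choice of the shift. *)
Lemma sum_psi_err_frac (R : realType) (g : R) (N n : nat) :
  (forall N, (0 < N)%N ->
    g <= \sum_(1 <= k < N.+1) k%:R^-1 - ln N%:R <= g + N%:R^-1) ->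
  (0 < n <= N)%N ->
  `|\sum_(1 <= m < (N %/ n).+1)
      (psi R (N %/ (n * m)) - N%:R / (n * m)%:R + g + 1)| <=
  2 * (ln N%:R - ln n%:R) + 4.
Proof.
move=> hg /andP[n0 nN]; have N0 := leq_trans n0 nN.
set y := (N %/ n)%N; pose x : R := N%:R / n%:R.
have y0 : (0 < y)%N by rewrite divn_gt0.
have xy : y%:R <= x by exact: natr_divn_le.
have yx : x <= y%:R + 1 by exact: natr_divn_ge.
have y1 : 1 <= y%:R :> R by rewrite ler1n.
have -> : ln N%:R - ln n%:R = ln x by rewrite ln_div ?posrE ?ltr0n.
have lxy : ln y%:R <= ln x by rewrite ler_ln ?posrE ?ltr0n // (lt_le_trans _ xy) ?ltr0n.
have -> : \sum_(1 <= m < y.+1) (psi R (N %/ (n * m)) - N%:R / (n * m)%:R + g + 1) =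
   \sum_(1 <= k < y.+1) ln k%:R - x * \sum_(1 <= k < y.+1) k%:R^-1 + (g + 1) * y%:R.
  rewrite sum_ln_psi mulr_sumr -sumrB.
  have -> : (g + 1) * y%:R = \sum_(1 <= m < y.+1) (g + 1) by rewrite sumr_const_nat subn1 mulr_natr.
  rewrite -big_split /=; apply: eq_bigr => m _.
  by rewrite divnMA natrM invfM mulrA addrA.
have g01 : 0 <= g <= 1.
  by have := hg 1%N isT; rewrite !big_nat1 ln1 subr0 invr1; lra.
have := hg _ y0; have := @sum_ln_ub R y y0; have := sum_ln_lb R y.
set H := \sum_(_ <= _ < _) _; set S := \sum_(_ <= _ < _) _.
have l0 : 0 <= ln y%:R :> R := ln_nat_ge0 R y.
have yi : y%:R * y%:R^-1 = 1 :> R by rewrite divff // pnatr_eq0 -lt0n.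
have yi0 : 0 <= y%:R^-1 :> R by rewrite invr_ge0.
move: H S (y%:R : R) x (y%:R^-1 : R) (ln y%:R : R) (ln x) xy yx y1 lxy g01 l0 yi yi0.
move=> S H y' x' yi l lx xy yx y1 lxy /andP[g0 g1] l0 yiE yi0 S1 S2 /andP[H1 H2].
(* [e] is the error of the harmonic sum and [t] below that of the floor; x e <= (y + 1)/y <= 2. *)
pose e := H - l - g.
have e0 : 0 <= e by rewrite /e; lra.
have e1 : e <= yi by rewrite /e; lra.
have x0 : 0 <= x' by lra.
have xe : x' * e <= 2.
  apply: le_trans (ler_wpM2l x0 e1) _; have := ler_wpM2r yi0 yx.
  by rewrite mulrDl yiE mul1r; have := ler_wpM2r yi0 y1; rewrite yiE; lra.
have xe0 : 0 <= x' * e by rewrite mulr_ge0.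
pose t := x' - y'.
have t0 : 0 <= t by rewrite /t; lra.
have t1 : t <= 1 by rewrite /t; lra.
have tl : t * l <= l by rewrite ler_piMl.
have tl0 : 0 <= t * l by rewrite mulr_ge0.
have tg : t * g <= 1 by rewrite mulr_ile1.
have tg0 : 0 <= t * g by rewrite mulr_ge0.
have -> : S - x' * H + (g + 1) * y' = (S - (y' * l - y')) - t * l - t * g - x' * e.
  by rewrite /t /e; ring.
rewrite ler_norml; lra.
Qed.

Lemma selberg_psi_err (R : realType) (N : nat) :
  `|ln N%:R * psi_err R N + \sum_(1 <= k < N.+1) vonMangoldt R k * psi_err R (N %/ k)|
  <= 40 * N%:R.
Proof.
case: (posnP N) => [->|N0]; first by rewrite big_geq // ln0 // mul0r addr0 normr0 mulr0.
have [g hg] := euler_constant R.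
have g01 : 0 <= g <= 1.
  by have := hg 1%N isT; rewrite !big_nat1 ln1 subr0 invr1; lra.
pose f k : R := psi R (N %/ k) - N%:R / k%:R + g + 1.
have T : `|ln N%:R * f 1%N + \sum_(1 <= k < N.+1) vonMangoldt R k * f k| <= 10 * N%:R.
  rewrite -tatuzawa_iseki //; apply: le_trans (ler_norm_sum _ _ _) _.
  (* The squares contribute 2 * 3 N and the linear terms 4 N, which makes 10 N. *)
  apply: (@le_trans _ _ (\sum_(1 <= n < N.+1)
     (2 * (ln N%:R - ln n%:R) ^+ 2 + 4 * (ln N%:R - ln n%:R)))).
    rewrite big_nat [leRHS]big_nat; apply: ler_sum => n hn.
    have n0 : (0 < n)%N by case/andP: hn.
    have l0 : 0 <= ln N%:R - ln n%:R :> R.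
      by rewrite subr_ge0 ler_ln ?posrE ?ltr0n // ler_nat; case/andP: hn.
    rewrite !normrM (ger0_norm l0).
    have := sum_psi_err_frac hg hn; rewrite -/(f _) => h.
    apply: (@le_trans _ _ (1 * (ln N%:R - ln n%:R) * (2 * (ln N%:R - ln n%:R) + 4))).
      apply: ler_pM => //; first by rewrite mulr_ge0.
      by rewrite ler_wpM2r // normr_mobius_le1.
    by rewrite mul1r mulrDr mulrCA -expr2 [_ * 4]mulrC.
  rewrite big_split /= -!mulr_sumr sumrB sumr_const_nat subn1 -mulr_natl.
  by have := sum_sqr_ln_le R N; have := sum_ln_lb R N; lra.
have lN := ln_nat_le R N; have lN0 := ln_nat_ge0 R N.
have pN := psi_le R N; have pN0 := psi_ge0 R N.
(* [D] is the price of replacing the real N/k in [f] by the integer quotient in [psi_err]. *)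
pose D := \sum_(1 <= k < N.+1) vonMangoldt R k * (N%:R / k%:R - (N %/ k)%:R).
have D0 : 0 <= D.
  apply: sumr_ge0 => k _; rewrite mulr_ge0 ?vonMangoldt_ge0 // subr_ge0.
  exact: natr_divn_le.
have D1 : D <= psi R N.
  rewrite /D /psi big_nat [leRHS]big_nat; apply: ler_sum => k /andP[k0 _].
  by rewrite ler_piMr ?vonMangoldt_ge0 // lerBlDl natr_divn_ge.
have E : \sum_(1 <= k < N.+1) vonMangoldt R k * f k =
   \sum_(1 <= k < N.+1) vonMangoldt R k * psi_err R (N %/ k) - D + (g + 1) * psi R N.
  rewrite /D /psi mulr_sumr -sumrB -big_split /=; apply: eq_bigr => k _.
  by rewrite /f /psi_err; ring.
have E1 : f 1%N = psi_err R N + (g + 1) by rewrite /f divn1 divr1 addrA.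
move: T; rewrite E E1 !ler_norml {E E1 f}.
move: (N%:R : R) (ln _) (psi R N) (psi_err R N) (\sum_(_ <= _ < _) _) lN lN0 pN pN0 D D0 D1.
move=> x l p e S lN lN0 pN pN0 D D0 D1 /andP[h1 h2]; case/andP: g01 => g0 g1.
have := mulr_ge0 g0 lN0; have := mulr_ge0 g0 pN0.
have := ler_wpM2r lN0 g1; have := ler_wpM2r pN0 g1.
move=> *; lra.
Qed.

(** Partial summation as an induction: each step adds psi(N) (ln(N + 1) - ln N), at most 11 by
    Chebyshev's bound. *)
Lemma sum_vonMangoldt_lndiff (R : realType) (N : nat) :
  0 <= \sum_(1 <= k < N.+1) vonMangoldt R k * (ln N%:R - ln k%:R) <= 11 * N%:R.
Proof.
elim: N => [|[|N] /andP[IH1 IH2]]; first by rewrite big_geq // mulr0 lexx.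
  by rewrite big_nat1 subrr mulr0 lexx mulr1 ler0n.
rewrite big_nat_recr //= subrr mulr0 addr0.
have -> : \sum_(1 <= k < N.+2) vonMangoldt R k * (ln N.+2%:R - ln k%:R) =
   \sum_(1 <= k < N.+2) vonMangoldt R k * (ln N.+1%:R - ln k%:R) +
   psi R N.+1 * (ln N.+2%:R - ln N.+1%:R).
  rewrite /psi mulr_suml -big_split /=; apply: eq_bigr => k _.
  by move: (ln _) (ln _) (ln _) => a b c; ring.
have d1 := @ln_natS_ub R N.+1 isT.
have d0 : 0 <= ln N.+2%:R - ln N.+1%:R :> R.
  by rewrite subr_ge0 ler_ln ?posrE ?ltr0n // ler_nat.
have h : psi R N.+1 * (ln N.+2%:R - ln N.+1%:R) <= 11.
  have := ler_pM (psi_ge0 R N.+1) d0 (psi_le R N.+1) d1.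
  by rewrite -mulrA divff ?mulr1 // pnatr_eq0.
have h0 := mulr_ge0 (psi_ge0 R N.+1) d0.
have E : N.+2%:R = N.+1%:R + 1 :> R by rewrite natr1.
have -> : 11 * N.+2%:R = 11 * N.+1%:R + 11 :> R by rewrite E mulrDr mulr1.
apply/andP; split; [exact: addr_ge0 IH1 h0 | exact: lerD IH2 h].
Qed.

(** This is the function Lambda_2 = mu * ln^2. *)
Definition selberg_coef (R : realType) (k : nat) : R :=
  vonMangoldt R k * ln k%:R +
  \sum_(1 <= d < k.+1 | (d %| k)%N) vonMangoldt R d * vonMangoldt R (k %/ d).

Lemma sum_vonMangoldt_conv (R : realType) (N : nat) (f : nat -> R) :
  \sum_(1 <= n < N.+1) vonMangoldt R n *
    \sum_(1 <= m < (N %/ n).+1) vonMangoldt R m * f (n * m)%N =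
  \sum_(1 <= k < N.+1)
    (\sum_(1 <= d < k.+1 | (d %| k)%N) vonMangoldt R d * vonMangoldt R (k %/ d)) * f k.
Proof.
transitivity (\sum_(1 <= n < N.+1) \sum_(1 <= m < (N %/ n).+1)
   (fun n k => vonMangoldt R n * vonMangoldt R (k %/ n) * f k) n (n * m)%N).
  rewrite big_nat [RHS]big_nat; apply: eq_bigr => n /andP[n0 _]; rewrite mulr_sumr.
  by apply: eq_bigr => m _; rewrite mulKn // mulrA.
rewrite (sum_hyperbola N (fun n k => vonMangoldt R n * vonMangoldt R (k %/ n) * f k)).
by apply: eq_bigr => k _; rewrite mulr_suml.
Qed.

(** The convolution part sums to sum Lambda(k) psi(N/k), and splitting psi into [psi_err] plus the
    integer quotient yields ln(N!) and the sum in [selberg_psi_err]. The constant is 40 + 11 + 1. *)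
Lemma selberg_sum (R : realType) (N : nat) :
  `|\sum_(1 <= k < N.+1) selberg_coef R k - 2 * N%:R * ln N%:R| <= 52 * N%:R.
Proof.
case: (posnP N) => [->|N0]; first by rewrite big_geq // !mulr0 mul0r subr0 normr0.
have -> : \sum_(1 <= k < N.+1) selberg_coef R k =
   ln N%:R * psi R N - \sum_(1 <= k < N.+1) vonMangoldt R k * (ln N%:R - ln k%:R) +
   (\sum_(1 <= k < N.+1) vonMangoldt R k * psi_err R (N %/ k) +
   \sum_(1 <= k < N.+1) ln k%:R).
  rewrite big_split /=; congr (_ + _).
    rewrite /psi mulr_sumr -sumrB; apply: eq_bigr => k _; ring.
  rewrite sum_ln_vonMangoldt -big_split /=.
  have := @sum_vonMangoldt_conv R N (fun=> 1).
  under [X in _ = X -> _]eq_bigr do rewrite mulr1.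
  move=> <-; apply: eq_bigr => k _; rewrite -mulrDr subrK; congr (_ * _).
  by apply: eq_bigr => m _; rewrite mulr1.
have := selberg_psi_err R N; have := sum_vonMangoldt_lndiff R N.
have := sum_ln_lb R N; have := @sum_ln_ub R N N0.
have : ln N%:R <= N%:R - 1 :> R by apply: ln_le_subr1; rewrite ltr0n.
rewrite /psi_err.
set S := \sum_(_ <= _ < _) vonMangoldt R _ * (psi R _ - _).
set T := \sum_(_ <= _ < _) vonMangoldt R _ * (_ - _).
set U := \sum_(_ <= _ < _) ln _.
rewrite !ler_norml; move: (psi R N) (N%:R : R) (ln N%:R : R) S T U => p x l S T U.
by move=> h1 h2 h3 /andP[h4 h5] /andP[h6 h7]; apply/andP; split; lra.
Qed.

Lemma psi_err_le (R : realType) (N : nat) : `|psi_err R N| <= 11 * N%:R.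
Proof.
have := psi_le R N; have := psi_ge0 R N; have : 0 <= N%:R :> R by [].
by rewrite /psi_err ler_norml; move: (psi R N) (N%:R : R) => *; lra.
Qed.

Lemma ln_divn_bounds (R : realType) (N k : nat) : (0 < k <= N)%N ->
  ln (N %/ k)%:R <= (ln N%:R - ln k%:R : R) <= (ln (N %/ k)%:R + (N %/ k)%:R^-1 : R).
Proof.
move=> /andP[k0 kN]; have N0 := leq_trans k0 kN.
have y0 : (0 < N %/ k)%N by rewrite divn_gt0.
have x0 : 0 < N%:R / k%:R :> R by rewrite divr_gt0 ?ltr0n.
rewrite -ln_div ?posrE ?ltr0n // ler_ln ?posrE ?ltr0n // natr_divn_le /=.
have := @ln_natS_ub R _ y0; rewrite lerBlDl; apply: le_trans.
by rewrite ler_ln ?posrE ?ltr0n // -natr1 natr_divn_ge.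
Qed.

(* Obtained by inserting [selberg_psi_err] into itself. *)
Lemma psi_err_iter (R : realType) (N : nat) : (0 < N)%N ->
  `|psi_err R N| * ln N%:R ^+ 2 <=
  \sum_(1 <= k < N.+1) selberg_coef R k * `|psi_err R (N %/ k)| +
  600 * N%:R * (ln N%:R + 1).
Proof.
move=> N0; pose T M := ln M%:R * psi_err R M +
   \sum_(1 <= k < M.+1) vonMangoldt R k * psi_err R (M %/ k).
have hT M : `|T M| <= 40 * M%:R := selberg_psi_err R M.
pose S1 := \sum_(1 <= k < N.+1) vonMangoldt R k * ln k%:R * psi_err R (N %/ k).
pose S2 := \sum_(1 <= k < N.+1)
    (\sum_(1 <= d < k.+1 | (d %| k)%N) vonMangoldt R d * vonMangoldt R (k %/ d))
      * psi_err R (N %/ k).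
pose S3 := \sum_(1 <= k < N.+1) vonMangoldt R k * T (N %/ k)%N.
(* The relation at [N %/ k] carries the logarithm of the integer quotient; [S4] corrects it to ln N
   - ln k. *)
pose S4 := \sum_(1 <= k < N.+1) vonMangoldt R k *
   ((ln N%:R - ln k%:R - ln (N %/ k)%:R) * psi_err R (N %/ k)).
have E : ln N%:R ^+ 2 * psi_err R N = ln N%:R * T N - S1 + S2 - S3 - S4.
  have -> : S2 = \sum_(1 <= n < N.+1) vonMangoldt R n *
    \sum_(1 <= m < (N %/ n).+1) vonMangoldt R m * psi_err R (N %/ n %/ m).
    rewrite /S2 -sum_vonMangoldt_conv; apply: eq_bigr => n _; congr (_ * _).
    by apply: eq_bigr => m _; rewrite divnMA.
  have -> : ln N%:R * T N = ln N%:R ^+ 2 * psi_err R N +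
      ln N%:R * \sum_(1 <= k < N.+1) vonMangoldt R k * psi_err R (N %/ k).
    by rewrite /T; ring.
  suff : \sum_(1 <= k < N.+1) ln N%:R * (vonMangoldt R k * psi_err R (N %/ k)) =
    S1 - \sum_(1 <= n < N.+1) vonMangoldt R n *
    (\sum_(1 <= m < (N %/ n).+1) vonMangoldt R m * psi_err R (N %/ n %/ m)) + S3 + S4.
    by rewrite -mulr_sumr => ->; ring.
  rewrite /S1 /S3 /S4 -sumrB -!big_split /=; apply: eq_bigr => k _.
  by rewrite /T; ring.
have B3 : `|S3| <= 40 * N%:R * (ln N%:R + 11).
  apply: le_trans (ler_norm_sum _ _ _) _.
  rewrite (le_trans _ (ler_wpM2l _ (sum_vonMangoldt_inv_ub R N0))) //.
  rewrite mulr_sumr; apply: ler_sum => k _.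
  rewrite normrM ger0_norm ?vonMangoldt_ge0 // mulrCA.
  rewrite ler_wpM2l ?vonMangoldt_ge0 // (le_trans (hT _)) // -mulrA ler_wpM2l //.
  exact: natr_divn_le.
have B4 : `|S4| <= 121 * N%:R.
  apply: le_trans (ler_norm_sum _ _ _) _.
  apply: (@le_trans _ _ (11 * psi R N)); last by have := psi_le R N; lra.
  rewrite /psi mulr_sumr big_nat [leRHS]big_nat; apply: ler_sum => k hk.
  rewrite normrM ger0_norm ?vonMangoldt_ge0 // mulrC ler_wpM2r ?vonMangoldt_ge0 //.
  have /andP[h1 h2] := @ln_divn_bounds R _ _ hk; rewrite normrM.
  have y0 : (0 < N %/ k)%N by case/andP: hk => *; rewrite divn_gt0.
  (* The logarithms differ by at most 1/y for y = [N/k], which the bound |R(y)| <= 11 y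
     compensates. *)
  rewrite ger0_norm ?subr_ge0 // (@le_trans _ _ ((N %/ k)%:R^-1 * (11 * (N %/ k)%:R))) //.
    apply: ler_pM => //; rewrite ?subr_ge0 ?psi_err_le //.
    by rewrite lerBlDl.
  by rewrite mulrCA mulVf ?mulr1 // pnatr_eq0 -lt0n.
(* Absolute values termwise turn the difference of the weights into their sum, which is
   [selberg_coef]. *)
have B12 : `|S2 - S1| <= \sum_(1 <= k < N.+1) selberg_coef R k * `|psi_err R (N %/ k)|.
  rewrite /S1 /S2 -sumrB; apply: le_trans (ler_norm_sum _ _ _) _.
  apply: ler_sum => k _; rewrite -mulrBl normrM ler_wpM2r //.
  apply: le_trans (ler_normB _ _) _; rewrite /selberg_coef addrC.
  rewrite (ger0_norm (mulr_ge0 (vonMangoldt_ge0 _ _) (ln_nat_ge0 _ _))) ger0_norm //.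
  by apply: sumr_ge0 => d _; rewrite mulr_ge0 ?vonMangoldt_ge0.
have l0 := ln_nat_ge0 R N.
have -> : `|psi_err R N| * ln N%:R ^+ 2 = `|ln N%:R ^+ 2 * psi_err R N|.
  by rewrite normrM mulrC (@ger0_norm _ (_ ^+ 2)) // sqr_ge0.
have B0 : `|ln N%:R * T N| <= 40 * N%:R * ln N%:R.
  by rewrite normrM ger0_norm // mulrC ler_wpM2r.
rewrite E (_ : _ - S4 = (S2 - S1) + (ln N%:R * T N - S3 - S4)); last by ring.
apply: le_trans (ler_normD _ _) _; apply: lerD => //.
apply: le_trans (ler_normB _ _) _; apply: le_trans (lerD (ler_normB _ _) (lexx _)) _.
have x0 : 0 <= N%:R :> R by [].
have xl0 := mulr_ge0 x0 l0.
move: B0 B3 B4; move: `|S3| `|S4| `|_ * T N| => s3 s4 t B0 B3 B4.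
by move: (ln N%:R : R) (N%:R : R) l0 x0 xl0 B0 B3 B4 => *; lra.
Qed.

Lemma sum_divn_summation (R : realType) (N : nat) (a g : nat -> R) : g 0%N = 0 ->
  \sum_(1 <= k < N.+1) a k * g (N %/ k)%N =
  \sum_(1 <= m < N.+1) (g m - g m.-1) * \sum_(1 <= k < (N %/ m).+1) a k.
Proof.
move=> g0.
transitivity (\sum_(1 <= k < N.+1) \sum_(1 <= m < (N %/ k).+1) a k * (g m - g m.-1)).
  apply: eq_bigr => k _; rewrite -mulr_sumr; congr (_ * _).
  by rewrite big_add1 /= telescope_sumr // g0 subr0.
rewrite sum_hyperbola_sym; apply: eq_bigr => m _; rewrite mulr_sumr.
by apply: eq_bigr => k _; rewrite mulrC.
Qed.

Lemma sum_abel (R : realType) (N : nat) (b g : nat -> R) : g 0%N = 0 ->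
  \sum_(1 <= m < N.+1) (g m - g m.-1) * b m =
  \sum_(1 <= m < N.+1) g m * (b m - b m.+1) + g N * b N.+1.
Proof.
move=> g0; elim: N => [|N IH]; first by rewrite !big_geq // g0 mul0r addr0.
by rewrite !(big_nat_recr N.+1) //= IH; ring.
Qed.

Lemma sum_inv_le (R : realType) (N : nat) : (0 < N)%N ->
  \sum_(1 <= k < N.+1) k%:R^-1 <= ln N%:R + 1 :> R.
Proof.
elim: N => [//|[|N] IH] _; first by rewrite big_nat1 ln1 add0r invr1.
rewrite big_nat_recr //=; have := IH isT; have := @ln_natS_lb R N.+1 isT.
by move: (ln _) (ln _) (_^-1) (\sum_(_ <= _ < _) _) => *; lra.
Qed.

Lemma psi_err_diff (R : realType) (m : nat) : (0 < m)%N ->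
  `| `|psi_err R m| - `|psi_err R m.-1| | <= vonMangoldt R m + 1.
Proof.
case: m => // m _ /=; apply: le_trans (ler_dist_dist _ _) _.
rewrite /psi_err psiS -natr1.
rewrite (_ : _ - _ = vonMangoldt R m.+1 - 1); last by ring.
by apply: le_trans (ler_normB _ _) _; rewrite normr1 ger0_norm ?vonMangoldt_ge0.
Qed.

(** Passing from [N/m] to x = N/m changes the main term by at most 2 (x - 1) + 2, so 52 becomes
    54. *)
Lemma selberg_sum_divn (R : realType) (N m : nat) : (0 < m <= N)%N ->
  `|\sum_(1 <= k < (N %/ m).+1) selberg_coef R k -
    2 * (N%:R / m%:R) * (ln N%:R - ln m%:R)| <= 54 * (N%:R / m%:R).
Proof.
move=> hm; have /andP[m0 mN] := hm.
have /andP[l1 l2] := @ln_divn_bounds R _ _ hm.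
have y0 : (0 < N %/ m)%N by rewrite divn_gt0.
have xy : (N %/ m)%:R <= N%:R / m%:R :> R := natr_divn_le _ _ _.
have yx : N%:R / m%:R <= (N %/ m)%:R + 1 :> R := natr_divn_ge _ _ m0.
have y1 : 1 <= (N %/ m)%:R :> R by rewrite ler1n.
have x0 : 0 < N%:R / m%:R :> R by rewrite divr_gt0 ?ltr0n // (leq_trans m0).
have lx : ln N%:R - ln m%:R <= N%:R / m%:R - 1 :> R.
  by rewrite -ln_div ?posrE ?ltr0n ?(leq_trans m0) // ln_le_subr1.
have ly := ln_nat_ge0 R (N %/ m)%N.
have yi : (N %/ m)%:R * (N %/ m)%:R^-1 = 1 :> R by rewrite divff // pnatr_eq0 -lt0n.
have := selberg_sum R (N %/ m)%N.
move: (\sum_(_ <= _ < _) _) (ln N%:R - ln m%:R) (N%:R / m%:R) ((N %/ m)%:R : R)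
  ((N %/ m)%:R^-1) (ln (N %/ m)%:R) l1 l2 xy yx y1 x0 lx ly yi.
move=> A lx x y yi ly l1 l2 xy yx y1 x0 lxx ly0 yiE; rewrite !ler_norml => /andP[h1 h2].
have p1 : y * (lx - ly) <= 1 by rewrite -yiE ler_wpM2l //; lra.
have p2 : 0 <= y * (lx - ly) by rewrite mulr_ge0 //; lra.
have p3 : (x - y) * lx <= lx by rewrite ler_piMl //; lra.
have p4 : 0 <= (x - y) * lx by rewrite mulr_ge0 //; lra.
have -> : A - 2 * x * lx = (A - 2 * y * ly) - 2 * ((x - y) * lx) - 2 * (y * (lx - ly)) by ring.
by apply/andP; split; lra.
Qed.

(* [m * m.+1] rather than [m ^ 2], so that the sums telescope. *)
Definition psi_err_weight (R : realType) (m : nat) : R :=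
  `|psi_err R m| / (m%:R * m.+1%:R).

Lemma psi_err_weight_ge0 (R : realType) (m : nat) : 0 <= psi_err_weight R m.
Proof. by rewrite divr_ge0 // mulr_ge0. Qed.

Lemma psi_err_weight_le (R : realType) (m : nat) : (0 < m)%N ->
  psi_err_weight R m <= 11 / m.+1%:R.
Proof.
move=> m0; rewrite /psi_err_weight invfM mulrA ler_wpM2r ?invr_ge0 //.
by rewrite ler_pdivrMr ?ltr0n // psi_err_le.
Qed.

(** Summation by parts exposes the partial sums of [selberg_coef], which are replaced by their main
    term [b]; a second summation by parts moves the differences back onto [b], whose differences are
    about 2 N ln(N/m) / (m (m + 1)). *)
Lemma psi_err_log_average (R : realType) (N : nat) : (0 < N)%N ->
  `|psi_err R N| * ln N%:R ^+ 2 <=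
  2 * N%:R * \sum_(1 <= m < N.+1) psi_err_weight R m * (ln N%:R - ln m%:R) +
  1500 * N%:R * (ln N%:R + 1).
Proof.
move=> N0; apply: le_trans (psi_err_iter R N0) _.
have l0 := ln_nat_ge0 R N.
have x0 : 0 <= N%:R :> R by [].
have xl0 := mulr_ge0 x0 l0.
pose g m := `|psi_err R m|.
have g0 : g 0%N = 0 by rewrite /g /psi_err /psi big_geq // subr0 normr0.
rewrite (sum_divn_summation N (selberg_coef R) g0).
pose b m : R := 2 * (N%:R / m%:R) * (ln N%:R - ln m%:R).
(* The increments of |R| are at most Lambda(m) + 1, so the errors add up to O(N ln N) by Mertens'
   bound. *)
have B1 : \sum_(1 <= m < N.+1) (g m - g m.-1) *
      \sum_(1 <= k < (N %/ m).+1) selberg_coef R k <=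
   \sum_(1 <= m < N.+1) (g m - g m.-1) * b m + 54 * N%:R * (2 * ln N%:R + 12).
  rewrite -lerBlDl -sumrB.
  apply: (@le_trans _ _ (\sum_(1 <= m < N.+1) (54 * N%:R) * (vonMangoldt R m / m%:R + m%:R^-1))).
    rewrite big_nat [leRHS]big_nat; apply: ler_sum => m hm.
    rewrite -mulrBr; apply: le_trans (ler_norm _) _; rewrite normrM.
    have m0 : (0 < m)%N by case/andP: hm.
    rewrite -mulrA [_ * (_ / _ + _)](_ : _ = (vonMangoldt R m + 1) * (N%:R / m%:R)); last by ring.
    by rewrite mulrCA; apply: ler_pM => //; [exact: psi_err_diff | exact: selberg_sum_divn].
  rewrite -mulr_sumr ler_wpM2l //; last first.
  rewrite big_split /=; have := sum_vonMangoldt_inv_ub R N0; have := @sum_inv_le R N N0.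
  by move: (\sum_(_ <= _ < _) _) (\sum_(_ <= _ < _) _) => *; lra.
have B2 : \sum_(1 <= m < N.+1) (g m - g m.-1) * b m <=
  2 * N%:R * \sum_(1 <= m < N.+1) psi_err_weight R m * (ln N%:R - ln m%:R) +
  22 * N%:R * (ln N%:R + 1).
  rewrite sum_abel //.
  (* The boundary term has a favourable sign, since ln N - ln(N + 1) <= 0. *)
  have bN : g N * b N.+1 <= 0.
    apply: mulr_ge0_le0; rewrite ?normr_ge0 //; apply: mulr_ge0_le0.
      by rewrite mulr_ge0 // divr_ge0.
    by rewrite subr_le0 ler_ln ?posrE ?ltr0n // ler_nat.
  apply: (@le_trans _ _ (\sum_(1 <= m < N.+1) g m * (b m - b m.+1))).
    by rewrite gerDl.
  apply: (@le_trans _ _ (\sum_(1 <= m < N.+1)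
    (2 * N%:R * (psi_err_weight R m * (ln N%:R - ln m%:R)) + 22 * N%:R * m%:R^-1))).
    rewrite big_nat [leRHS]big_nat; apply: ler_sum => m /andP[m0 _].
    have h1 := @ln_natS_ub R m m0; have h2 := psi_err_weight_le R m0.
    have mm : m%:R != 0 :> R by rewrite pnatr_eq0 -lt0n.
    have mm1 : m.+1%:R != 0 :> R by rewrite pnatr_eq0.
    have -> : g m * (b m - b m.+1) = 2 * N%:R * (psi_err_weight R m * (ln N%:R - ln m%:R)) +
       2 * N%:R * (psi_err_weight R m * m%:R * (ln m.+1%:R - ln m%:R)).
      rewrite /b /psi_err_weight /g; have E : m.+1%:R = m%:R + 1 :> R by rewrite natr1.
      move: mm1; rewrite -/(m.+1%:R) E; move: (ln _) (ln _) (ln _) => l1 l2 l3 mm1.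
      by field; rewrite mm mm1.
    rewrite lerD2l (_ : 22 * N%:R / m%:R = 2 * N%:R * (11 / m%:R)); last by ring.
    rewrite ler_wpM2l ?mulr_ge0 //.
    apply: (@le_trans _ _ (psi_err_weight R m * (m%:R * m%:R^-1))).
      by rewrite -[leLHS]mulrA ler_wpM2l ?psi_err_weight_ge0 // ler_wpM2l.
    rewrite divff // mulr1 (le_trans h2) // ler_wpM2l // lef_pV2 ?posrE ?ltr0n // ler_nat.
    exact: leqnSn.
  rewrite big_split /= -!mulr_sumr lerD2l ler_wpM2l ?mulr_ge0 //.
  exact: sum_inv_le.
move: B1 B2; move: (\sum_(_ <= _ < _) _) (\sum_(_ <= _ < _) _) (\sum_(_ <= _ < _) _).
move: (ln N%:R : R) (N%:R : R) l0 x0 xl0 => *; lra.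
Qed.

(** * The prime number theorem *)

Lemma ln_nat_large (R : realType) (T : R) :
  exists2 N0 : nat, (0 < N0)%N & forall N, (N0 <= N)%N -> T <= ln N%:R.
Proof.
exists (Num.truncn (expR T)).+1 => // N hN.
have h : expR T <= N%:R.
  by rewrite (le_trans (ltW (truncnS_gt _))) // ler_nat.
by rewrite -[T]expRK ler_ln ?posrE ?expR_gt0 // (lt_le_trans (expR_gt0 _) h).
Qed.

(** Between z and m, Lambda(k) ln z <= [selberg_coef R k], so Selberg's formula at m and z bounds
    the left side. The error is 52 (m + z) plus 2 m from ln m <= ln z + 1, at most 160 z. *)
Lemma psi_short (R : realType) (z m : nat) : (0 < z)%N -> (z <= m <= 2 * z)%N ->
  (psi R m - psi R z) * ln z%:R <= 2 * (m%:R - z%:R) * ln z%:R + 160 * z%:R.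
Proof.
move=> z0 /andP[zm m2].
have E f : \sum_(1 <= k < m.+1) f k - \sum_(1 <= k < z.+1) f k = \sum_(z.+1 <= k < m.+1) f k :> R.
  by rewrite [X in X - _](big_cat_nat (n := z.+1)) //= [X in X - _]addrC addrK.
have h1 : (psi R m - psi R z) * ln z%:R <=
    \sum_(1 <= k < m.+1) selberg_coef R k - \sum_(1 <= k < z.+1) selberg_coef R k.
  rewrite !E mulr_suml big_nat [leRHS]big_nat; apply: ler_sum => k /andP[k1 _].
  rewrite -[leLHS]addr0 lerD //; last by apply: sumr_ge0 => d _; rewrite mulr_ge0 ?vonMangoldt_ge0.
  rewrite ler_wpM2l ?vonMangoldt_ge0 // ler_ln ?posrE ?ltr0n ?ler_nat ?(ltnW k1) //.
  by rewrite (leq_trans z0) // ltnW.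
have := selberg_sum R m; have := selberg_sum R z; rewrite !ler_norml.
have m0 : (0 < m)%N by apply: leq_trans zm.
have lm : ln m%:R <= ln z%:R + 1 :> R.
  have := @ln_le_subr1 R (m%:R / z%:R); rewrite divr_gt0 ?ltr0n // => /(_ isT).
  rewrite ln_div ?posrE ?ltr0n // => h.
  have : m%:R / z%:R <= 2 :> R by rewrite ler_pdivrMr ?ltr0n // -natrM ler_nat.
  by lra.
have m2' : m%:R <= 2 * z%:R :> R by rewrite -natrM ler_nat.
have m0' : 0 <= m%:R :> R by [].
have := ler_wpM2l m0' lm.
move: h1; move: (\sum_(_ <= _ < _) _) (\sum_(_ <= _ < _) _) (_ * ln z%:R).
move: (m%:R : R) (z%:R : R) (ln _) (ln _) m2' => *; lra.
Qed.

(** psi increases by at least 0 and by at most about 2 (m - z), so after subtracting m - z the error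
    term moves with slope at most about 1 in either direction. *)
Lemma psi_err_short (R : realType) (eps : R) : 0 < eps ->
  exists2 Z0 : nat, (0 < Z0)%N & forall z m, (Z0 <= z)%N -> (z <= m <= 2 * z)%N ->
    `|psi_err R m - psi_err R z| <= m%:R - z%:R + eps * z%:R.
Proof.
move=> e0; have [Z0 Z1 hZ] := ln_nat_large (160 / eps).
exists Z0 => // z m hz hm; have z0 : (0 < z)%N by apply: leq_trans hz.
have l0 : 0 < ln z%:R :> R by apply: lt_le_trans (hZ _ hz); rewrite divr_gt0.
have h := psi_short R z0 hm; have hp : psi R z <= psi R m.
  case/andP: hm => zm _; rewrite /psi (big_cat_nat (m := 1%N) (n := z.+1) (p := m.+1)) //=.
  by rewrite lerDl; apply: sumr_ge0 => k _; exact: vonMangoldt_ge0.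
have h2 : psi R m - psi R z <= 2 * (m%:R - z%:R) + eps * z%:R.
  rewrite -(ler_pM2r l0) (le_trans h) // [leRHS]mulrDl lerD2l mulrAC ler_wpM2r //.
  by rewrite mulrC -ler_pdivrMr // hZ.
have ez : 0 <= eps * z%:R by rewrite mulr_ge0 // ltW.
have zm : z%:R <= m%:R :> R by rewrite ler_nat; case/andP: hm.
by rewrite /psi_err ler_norml; apply/andP; split; lra.
Qed.

Lemma sum_invS_le (R : realType) (Y Z : nat) : (0 < Y <= Z)%N ->
  \sum_(Y <= m < Z) m.+1%:R^-1 <= ln Z%:R - ln Y%:R :> R.
Proof.
move=> /andP[Y0 YZ]; rewrite -(telescope_sumr (fun n => ln n%:R : R)) //.
rewrite big_nat [leRHS]big_nat; apply: ler_sum => m /andP[hm _].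
by rewrite ln_natS_lb // (leq_trans Y0).
Qed.

(** By partial summation this is sum Lambda(m)/m - psi(N)/(N + 1) - sum 1/(m + 1), and by Mertens'
    estimates the two terms ln N cancel. *)
Lemma sum_psi_err_bounded (R : realType) (N : nat) :
  `|\sum_(1 <= m < N.+1) psi_err R m / (m%:R * m.+1%:R)| <= 14.
Proof.
case: (posnP N) => [->|N0]; first by rewrite big_geq // normr0.
have p0 : psi R 0 = 0 by rewrite /psi big_geq.
have inv m : (0 < m)%N -> m%:R^-1 - m.+1%:R^-1 = (m%:R * m.+1%:R)^-1 :> R.
  move=> m0; have mm : m%:R != 0 :> R by rewrite pnatr_eq0 -lt0n.
  have mm1 : m.+1%:R != 0 :> R by rewrite pnatr_eq0.
  have E : m.+1%:R = m%:R + 1 :> R by rewrite natr1.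
  by move: mm1; rewrite E => mm1; field; rewrite mm mm1.
have -> : \sum_(1 <= m < N.+1) psi_err R m / (m%:R * m.+1%:R) =
   \sum_(1 <= m < N.+1) vonMangoldt R m / m%:R - psi R N / N.+1%:R -
   \sum_(1 <= m < N.+1) m.+1%:R^-1.
  have := @sum_abel R N (fun m => m%:R^-1) (psi R) p0.
  have -> : \sum_(1 <= m < N.+1) (psi R m - psi R m.-1) / m%:R =
            \sum_(1 <= m < N.+1) vonMangoldt R m / m%:R.
    rewrite big_nat [RHS]big_nat; apply: eq_bigr => -[//|m] _.
    by rewrite psiS /= addrC addKr.
  move=> ->; rewrite addrK -sumrB big_nat [RHS]big_nat; apply: eq_bigr => m /andP[m0 _].
  rewrite inv // /psi_err mulrBl; congr (_ - _).
  by rewrite invfM mulrA divff ?mul1r // pnatr_eq0 -lt0n.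
have h1 := sum_vonMangoldt_inv_ub R N0; have h2 := sum_vonMangoldt_inv_lb R N0.
have h3 : 0 <= psi R N / N.+1%:R <= 11.
  rewrite divr_ge0 ?psi_ge0 //= ler_pdivrMr ?ltr0n // (le_trans (psi_le _ _)) //.
  by rewrite ler_wpM2l // ler_nat leqnSn.
have h4 : \sum_(1 <= m < N.+1) m.+1%:R^-1 <= ln N%:R + 1 :> R.
  apply: (le_trans _ (sum_inv_le R N0)); rewrite big_nat [leRHS]big_nat; apply: ler_sum => m /andP[m0 _].
  by rewrite lef_pV2 ?posrE ?ltr0n // ler_nat leqnSn.
have h5 : ln N%:R - 1 <= \sum_(1 <= m < N.+1) m.+1%:R^-1 :> R.
  apply: (@le_trans _ _ (ln N.+2%:R - ln 2)).
    have : ln 2 <= 2 - 1 :> R by apply: ln_le_subr1.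
    have : ln N%:R <= ln N.+2%:R :> R by rewrite ler_ln ?posrE ?ltr0n // ler_nat ltnW.
    by move: (ln _) (ln _) (ln _) => *; lra.
  rewrite -(telescope_sumr (fun n => ln n.+1%:R : R)) //.
  by apply: ler_sum => m _; exact: ln_natS_ub.
case/andP: h3; move: h1 h2 h4 h5; rewrite ler_norml.
move: (\sum_(_ <= _ < _) _) (\sum_(_ <= _ < _) _) (psi R N / _) (ln _) => *.
by apply/andP; split; lra.
Qed.

(** On integers a sign change need not produce a zero; the third case records that |f z| is at most
    the jump to f (z + 1). *)
Lemma sign_change (R : realType) (f : nat -> R) (Y Z : nat) :
  [\/ forall m, (Y <= m < Z)%N -> 0 <= f m,
      forall m, (Y <= m < Z)%N -> f m <= 0 |
      exists z, [/\ (Y <= z)%N, (z.+1 < Z)%N & `|f z| <= `|f z.+1 - f z|]].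
Proof.
elim: Z => [|Z IH]; first by apply: Or31 => m; rewrite ltn0 andbF.
have step m : (Y <= m < Z.+1)%N -> (Y <= m < Z)%N \/ m = Z /\ (Y <= Z)%N.
  by move=> /andP[h1]; rewrite ltnS leq_eqVlt => /orP[/eqP E|h2];
    [right; rewrite -E | left; rewrite h1].
have [YZ|ZY] := ltnP Y Z; last first.
  have [h|h] := leP 0 (f Z); [apply: Or31 | apply: Or32] => m /step[|[-> _]] //.
  - by move=> /andP[h1 /(leq_ltn_trans h1)]; rewrite ltnNge ZY.
  - by move=> /andP[h1 /(leq_ltn_trans h1)]; rewrite ltnNge ZY.
  - exact: ltW.
have hZ : (Y <= Z.-1 < Z)%N by case: Z YZ {IH step} => // Z; rewrite ltnS => -> /=.
have EZ : Z.-1.+1 = Z by case: Z YZ {IH step hZ}.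
case: IH => [h|h|[z [h1 h2 h3]]].
- have [hf|hf] := leP 0 (f Z); first by apply: Or31 => m /step[/h|[-> _]].
  apply: Or33; exists Z.-1; rewrite EZ; split => //; first by case/andP: hZ.
  have := h _ hZ => h0; rewrite ger0_norm // distrC ger0_norm ?subr_ge0; last first.
    by rewrite (le_trans (ltW hf)).
  by rewrite lerBrDl gerDr ltW.
- have [hf|hf] := leP (f Z) 0; first by apply: Or32 => m /step[/h|[-> _]].
  apply: Or33; exists Z.-1; rewrite EZ; split => //; first by case/andP: hZ.
  have := h _ hZ => h0; rewrite ler0_norm // ger0_norm ?subr_ge0; last first.
    by rewrite (le_trans h0) // ltW.
  by rewrite lerDr ltW.
- by apply: Or33; exists z; split => //; rewrite ltnW.
Qed.

Lemma sum_nat_split (R : realType) (a b c : nat) (f : nat -> R) :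
  (a <= b)%N -> (b <= c)%N ->
  \sum_(a <= k < c) f k = \sum_(a <= k < b) f k + \sum_(b <= k < c) f k.
Proof. by move=> ab bc; rewrite (big_cat_nat ab bc). Qed.

Lemma sum_weight_const_sign (R : realType) (Y Z : nat) : (0 < Y <= Z)%N ->
  (forall m, (Y <= m < Z)%N -> 0 <= psi_err R m) \/
  (forall m, (Y <= m < Z)%N -> psi_err R m <= 0) ->
  \sum_(Y <= m < Z) psi_err_weight R m <= 28.
Proof.
move=> /andP[Y0 YZ] hs.
have B : `|\sum_(Y <= m < Z) psi_err R m / (m%:R * m.+1%:R)| <= 28.
  have := sum_psi_err_bounded R Z.-1; have := sum_psi_err_bounded R Y.-1.
  rewrite !prednK ?(leq_trans Y0) // (sum_nat_split _ Y0 YZ) !ler_norml.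
  move: (\sum_(_ <= _ < _) _) (\sum_(_ <= _ < _) _) => x y.
  by move=> /andP[? ?] /andP[? ?]; apply/andP; split; lra.
apply: le_trans B.
case: hs => hs; [rewrite -[leRHS]normr_id | rewrite -[leRHS]normrN].
  apply: le_trans (ler_norm _); apply: le_trans (ler_norm _).
  rewrite big_nat [leRHS]big_nat; apply: ler_sum => m hm.
  by rewrite /psi_err_weight ger0_norm // hs.
apply: le_trans (ler_norm _); rewrite -sumrN.
rewrite big_nat [leRHS]big_nat; apply: ler_sum => m hm.
by rewrite /psi_err_weight ler0_norm ?hs // mulNr.
Qed.

Lemma psi_err_weight_le_of (R : realType) (a : R) (m : nat) : (0 < m)%N ->
  `|psi_err R m| <= a * m%:R -> psi_err_weight R m <= a * m.+1%:R^-1.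
Proof.
move=> m0 h; rewrite /psi_err_weight invfM mulrA ler_wpM2r ?invr_ge0 //.
by rewrite ler_pdivrMr ?ltr0n.
Qed.

(* A sign change of [psi_err] makes it small on an interval of fixed logarithmic
   length, which lowers the logarithmic average over the window. *)
Lemma sum_weight_sign_change (R : realType) (al a d : R) (Y Z z : nat) :
  0 < al <= a -> 0 < d <= 1 ->
  (0 < Y <= z)%N -> (2 * z < Z)%N ->
  (forall m, (Y <= m < Z)%N -> `|psi_err R m| <= a * m%:R) ->
  (forall m, (z <= m)%N -> m%:R <= (1 + d) * z%:R -> `|psi_err R m| <= al / 2 * m%:R) ->
  \sum_(Y <= m < Z) psi_err_weight R m <=
    a * (ln Z%:R - ln Y%:R) - al * d / 6.
Proof.
move=> /andP[al0 ala] /andP[d0 d1] /andP[Y0 Yz] zZ ha hsm.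
have z0 : (0 < z)%N by apply: leq_trans Yz.
have zR : 0 < z%:R :> R by rewrite ltr0n.
have dz0 : 0 <= d * z%:R by rewrite mulr_ge0 // ltW.
(* The interval [z, w) contains [d z] + 1 integers, all at most (1 + d) z. *)
set w := (z + Num.truncn (d * z%:R)).+1.
have hw m : (m < w)%N -> m%:R <= (1 + d) * z%:R.
  rewrite ltnS -(ler_nat R) natrD => h; rewrite (le_trans h) // mulrDl mul1r lerD2l.
  by rewrite truncn_le.
have w2 : (w <= (2 * z).+1)%N.
  rewrite /w mul2n -addnn ltnS leq_add2l -(ler_nat R).
  by rewrite (@le_trans _ _ (d * z%:R)) ?truncn_le // ler_piMl // ltW.
have wZ : (w <= Z)%N by apply: leq_trans zZ.
have zw : (z <= w)%N by rewrite /w -addnS leq_addr.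
have YZ : (Y <= Z)%N by rewrite (leq_trans Yz) // (leq_trans zw).
have v m : (Y <= m < Z)%N -> psi_err_weight R m <= a * m.+1%:R^-1.
  move=> hm; apply: psi_err_weight_le_of; last exact: ha.
  by case/andP: hm => h _; apply: leq_trans h.
have h1 : \sum_(Y <= m < z) psi_err_weight R m <= a * \sum_(Y <= m < z) m.+1%:R^-1.
  rewrite mulr_sumr big_nat [leRHS]big_nat; apply: ler_sum => m /andP[m1 m2].
  by apply: v; rewrite m1 (leq_trans m2) // (leq_trans zw).
have h3 : \sum_(w <= m < Z) psi_err_weight R m <= a * \sum_(w <= m < Z) m.+1%:R^-1.
  rewrite mulr_sumr big_nat [leRHS]big_nat; apply: ler_sum => m /andP[m1 m2].
  by apply: v; rewrite m2 (leq_trans Yz) // (leq_trans zw).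
have h2 : \sum_(z <= m < w) psi_err_weight R m <= (al / 2) * \sum_(z <= m < w) m.+1%:R^-1.
  rewrite mulr_sumr big_nat [leRHS]big_nat; apply: ler_sum => m /andP[m1 m2].
  apply: psi_err_weight_le_of; first by apply: leq_trans m1.
  by apply: hsm => //; apply: hw.
(* More than d z terms, each at least 1/(3 z) because m + 1 <= 2 z + 1. *)
have h4 : d / 3 <= \sum_(z <= m < w) m.+1%:R^-1.
  apply: (@le_trans _ _ (\sum_(z <= m < w) (3 * z%:R)^-1)).
    rewrite sumr_const_nat /w -addnS addKn -[leRHS]mulr_natl ler_pdivlMr ?mulr_gt0 //.
    rewrite (_ : d / 3 * _ = d * z%:R); last by field.
    by rewrite ltW // truncnS_gt.
  rewrite big_nat [leRHS]big_nat; apply: ler_sum => m /andP[_ m2].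
  rewrite lef_pV2 ?posrE ?ltr0n ?mulr_gt0 // -natrM ler_nat.
  by rewrite (leq_trans m2) // (leq_trans w2) // -add1n -[3%N]/(1 + 2)%N mulnDl mul1n leq_add2r.
have h5 := @sum_invS_le R Y Z; rewrite Y0 YZ in h5; have {}h5 := h5 isT.
have zZ' : (z <= Z)%N by apply: leq_trans wZ.
rewrite (sum_nat_split _ Yz zZ') (sum_nat_split _ zw wZ) in h5.
rewrite (sum_nat_split _ Yz zZ') (sum_nat_split _ zw wZ).
move: h1 h2 h3 h4 h5; set s1 := \sum_(z <= m < w) m.+1%:R^-1.
move: (ln Z%:R - ln Y%:R) s1 (\sum_(Y <= m < z) m.+1%:R^-1) (\sum_(w <= m < Z) m.+1%:R^-1).
move: (\sum_(_ <= _ < _) _) (\sum_(_ <= _ < _) _) (\sum_(_ <= _ < _) _).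
move=> A B C l s s2 s3 h1 h2 h3 h4 h5.
have a0 : 0 <= a by rewrite ltW // (lt_le_trans al0).
have k1 := ler_wpM2l a0 h5.
have s0 : 0 <= s by rewrite (le_trans _ h4) // divr_ge0 // ltW.
(* The gain on [z, w): the coefficient there is al/2 instead of a >= al. *)
have k2 : al / 2 * (d / 3) <= (a - al / 2) * s.
  by apply: ler_pM => //; rewrite ?divr_ge0 ?(ltW al0) ?(ltW d0) //; lra.
lra.
Qed.

(** The windows [Y, K Y) tile the range; the last, incomplete one accounts for the extra b ln K. *)
Lemma window_chain (R : realType) (b : R) (K Y1 : nat) (v : nat -> R) :
  (1 < K)%N -> (0 < Y1)%N -> 0 <= b -> (forall m, 0 <= v m) ->
  (forall Y, (Y1 <= Y)%N -> \sum_(Y <= m < K * Y) v m <= b * ln K%:R) ->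
  forall Y N, (Y1 <= Y <= N)%N ->
    \sum_(Y <= m < N) v m <= b * (ln N%:R - ln Y%:R) + b * ln K%:R.
Proof.
move=> K1 Y10 b0 v0 hW Y N /andP[YY YN].
have lK : 0 <= ln K%:R :> R := ln_nat_ge0 R K.
have [n] := ubnP (N - Y); elim: n Y YY YN => // n IH Y YY YN hn.
have Y0 : (0 < Y)%N by apply: leq_trans YY.
have [h|h] := leqP N (K * Y)%N.
  apply: (@le_trans _ _ (\sum_(Y <= m < K * Y) v m)).
    by rewrite (sum_nat_split _ YN h) lerDl sumr_ge0.
  apply: (le_trans (hW _ YY)); rewrite lerDr mulr_ge0 // subr_ge0.
  by rewrite ler_ln ?posrE ?ltr0n ?ler_nat // (leq_trans Y0).
have hY : (Y < K * Y)%N by rewrite -[X in (X < _)%N]mul1n ltn_pmul2r.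
rewrite (sum_nat_split _ (ltnW hY) (ltnW h)).
have := IH (K * Y)%N (leq_trans YY (ltnW hY)) (ltnW h).
rewrite natrM lnM ?posrE ?ltr0n ?(ltn_trans _ K1) // => /(_ _) h1.
have := hW _ YY; have {}h1 := h1 (_ : (N - K * Y < n)%N).
have : (N - K * Y < n)%N by lia.
move=> /h1; move: (\sum_(_ <= _ < _) _) (\sum_(_ <= _ < _) _) => *; lra.
Qed.

(** Partial summation as an induction: with l' the next logarithm, b l (l' - l) <= b/2 (l'^2 - l^2),
    the discrete form of integrating b ln. *)
Lemma sum_log_weight (R : realType) (b C : R) (v : nat -> R) :
  0 <= b -> 0 <= C ->
  (forall N, (0 < N)%N -> \sum_(1 <= m < N.+1) v m <= b * ln N%:R + C) ->
  forall N, (0 < N)%N -> \sum_(1 <= m < N.+1) v m * (ln N%:R - ln m%:R) <=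
    b / 2 * ln N%:R ^+ 2 + C * ln N%:R.
Proof.
move=> b0 C0 hv; elim=> [//|[|N] IH] _.
  by rewrite big_nat1 subrr mulr0 ln1 expr0n /= !mulr0 addr0.
have := IH isT; have := hv N.+1 isT.
rewrite [in X in _ -> _ -> X]big_nat_recr //= subrr mulr0 addr0.
have -> : \sum_(1 <= i < N.+2) v i * (ln N.+2%:R - ln i%:R) =
   \sum_(1 <= i < N.+2) v i * (ln N.+1%:R - ln i%:R) +
   (\sum_(1 <= i < N.+2) v i) * (ln N.+2%:R - ln N.+1%:R).
  rewrite mulr_suml -big_split /=; apply: eq_bigr => i _.
  by move: (ln _) (ln _) (ln _) => *; ring.
have d0 : 0 <= ln N.+2%:R - ln N.+1%:R :> R.
  by rewrite subr_ge0 ler_ln ?posrE ?ltr0n // ler_nat.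
move: (ln N.+1%:R : R) (ln N.+2%:R : R) (\sum_(1 <= m < N.+2) v m)
  (\sum_(1 <= m < N.+2) v m * (ln N.+1%:R - ln m%:R)) d0 => l l' V S d0 h1 h2.
have := ler_wpM2r d0 h1; have := mulr_ge0 b0 (sqr_ge0 (l - l')).
by move=> h3 h4; lra.
Qed.

(** The decisive step: an asymptotic bound [al] yields a smaller logarithmic average over every long
    window, and [psi_err_log_average] turns this into a smaller pointwise bound. *)
Lemma psi_err_improve (R : realType) (al : R) : 0 < al <= 11 ->
  (forall eta, 0 < eta -> exists Y, forall m, (Y <= m)%N ->
     `|psi_err R m| <= (al + eta) * m%:R) ->
  exists c, 0 < c < al /\ exists Y, forall m, (Y <= m)%N ->
     `|psi_err R m| <= (al - c) * m%:R.
Proof.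
have aux (x c t a : R) : 1 <= x -> (2 * c + 3000) * 2 * x <= x * t * x ->
    2 * ((a - t) / 2 * x ^+ 2 + c * x) + 1500 * (x + 1) <= (a - t / 2) * x ^+ 2.
  by move=> h1 h2; lra.
move=> /andP[al0 al11] hal.
(* Near a sign change z the estimates below give |R(m)| <= 4 d z, well under al/2 z = 11 d z;
   [al <= 11] keeps d <= 1. *)
pose d := al / 22.
have d0 : 0 < d by rewrite divr_gt0.
have d1 : d <= 1 by rewrite /d; lra.
have [Z0 Z00 hZ0] := psi_err_short d0.
have [Z1 Z10 hZ1] : exists2 Z1 : nat, (Z0 <= Z1)%N & forall z, (Z1 <= z)%N -> 1 <= d * z%:R.
  exists (maxn Z0 (Num.truncn d^-1).+1); first exact: leq_maxl.
  move=> z; rewrite geq_max => /andP[_ h].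
  rewrite -ler_pdivrMl // mulr1 (le_trans (ltW (truncnS_gt _))) // ler_nat //.
have hsm z m : (Z1 <= z)%N -> `|psi_err R z| <= `|psi_err R z.+1 - psi_err R z| ->
   (z <= m)%N -> m%:R <= (1 + d) * z%:R -> `|psi_err R m| <= al / 2 * m%:R.
  move=> hz h zm hm; have hz0 := leq_trans Z10 hz.
  have z0 : (0 < z)%N by apply: leq_trans hz0.
  have m2 : (z <= m <= 2 * z)%N.
    rewrite zm -(ler_nat R) (le_trans hm) // natrM ler_wpM2r //.
    by rewrite -[2%:R]/(1 + 1) lerD2l.
  have z2 : (z <= z.+1 <= 2 * z)%N by rewrite leqnSn /= mul2n -addnn -addn1 leq_add2l.
  have h1 := hZ0 z m hz0 m2; have h2 := hZ0 z z.+1 hz0 z2; have h3 := hZ1 z hz.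
  have E : z.+1%:R = z%:R + 1 :> R by rewrite natr1.
  have zmR : z%:R <= m%:R :> R by rewrite ler_nat.
  have h4 : `|psi_err R m| <= `|psi_err R m - psi_err R z| + `|psi_err R z|.
    by rewrite -{1}[psi_err R m](subrK (psi_err R z)) ler_normD.
  have h5 : al / 2 * z%:R <= al / 2 * m%:R by rewrite ler_wpM2l // divr_ge0 // ltW.
  move: h h1 h2 h3 h4 h5 hm; rewrite E /d.
  move: `|psi_err R m| `|_ - _| `|_ - _| `|_| (m%:R : R) (z%:R : R) => *; lra.
(* A sign change is sought in [Y, K' Y); the factor 2 leaves room for the short interval after it.
   The size of K' makes b ln K at least 50, more than the 28 + al + eta of a window with constant
   sign. *)
pose K' := (Num.truncn (expR (100 / al))).+1; pose K := (2 * K')%N.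
have K'0 : (0 < K')%N by [].
have K1 : (1 < K)%N by rewrite /K mul2n -addnn; apply: (leq_trans (_ : 1 < 1 + 1)%N); rewrite ?leq_add.
pose l : R := ln K%:R.
have hl : 100 / al <= l.
  rewrite -[100 / al]expRK ler_ln ?posrE ?expR_gt0 ?ltr0n ?(ltn_trans _ K1) //.
  rewrite (le_trans (ltW (truncnS_gt _))) // ler_nat -/K' /K leq_pmull //.
have al100 : 100 <= l * al by rewrite -ler_pdivrMr.
have l9 : 9 <= l.
  apply: le_trans hl; rewrite ler_pdivlMr //; lra.
(* [s] is the gain in a window with a sign change; [eta] is chosen so that (al + eta) l - s = (al -
   eta) l. *)
pose s := al * d / 6; pose eta := s / (2 * l).
have s0 : 0 < s by rewrite /s divr_gt0 // mulr_gt0.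
have eta0 : 0 < eta by rewrite /eta divr_gt0 // mulr_gt0 // (lt_le_trans _ l9).
have etal : 2 * (eta * l) = s.
  by rewrite /eta; field; rewrite gt_eqF // (lt_le_trans _ l9).
have eta_al : eta <= al / 12.
  rewrite /eta ler_pdivrMr ?mulr_gt0 ?(lt_le_trans _ l9) // /s /d.
  have h := ler_wpM2l (ltW al0) al11; have h' := ler_wpM2l (ltW al0) l9.
  by lra.
have [Y0 hY0] := hal eta eta0.
pose Y1 := maxn Y0 (maxn Z1 1); pose b := al - eta.
have Y1P Y : (Y1 <= Y)%N -> [/\ (Y0 <= Y)%N, (Z1 <= Y)%N & (0 < Y)%N].
  by rewrite !geq_max => /and3P[-> -> ->].
have b0 : 0 <= b by rewrite /b; lra.
have bl : 50 <= b * l.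
  have h := ler_wpM2r (le_trans (ler0n R 9) l9) eta_al.
  by rewrite /b mulrBl; lra.
have Y10 : (0 < Y1)%N by rewrite leq_max leq_maxr orbT.
have lnK Y : (0 < Y)%N -> ln (K * Y)%:R - ln Y%:R = l.
  by move=> Yp; rewrite natrM lnM ?posrE ?ltr0n ?(ltn_trans _ K1) // addrK.
have W Y : (Y1 <= Y)%N -> \sum_(Y <= m < K * Y) psi_err_weight R m <= b * l.
  move=> /Y1P[YY0 YZ1 Yp].
  have E : (K * Y = 2 * (K' * Y))%N by rewrite /K mulnA.
  have YK' : (Y <= K' * Y)%N by rewrite leq_pmull.
  have K'Y : (0 < K' * Y)%N by rewrite muln_gt0 Yp.
  have const : (forall m, (Y <= m < K' * Y)%N -> 0 <= psi_err R m) \/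
     (forall m, (Y <= m < K' * Y)%N -> psi_err R m <= 0) ->
     \sum_(Y <= m < K * Y) psi_err_weight R m <= b * l.
    move=> h; have h1 := @sum_weight_const_sign R Y (K' * Y)%N; rewrite Yp YK' in h1.
    have {}h1 := h1 isT h; rewrite E (sum_nat_split _ YK'); last by rewrite leq_pmull.
    have h2 : \sum_(K' * Y <= m < 2 * (K' * Y)) psi_err_weight R m <=
        (al + eta) * \sum_(K' * Y <= m < 2 * (K' * Y)) m.+1%:R^-1.
      rewrite mulr_sumr big_nat [leRHS]big_nat; apply: ler_sum => m /andP[m1 _].
      apply: psi_err_weight_le_of; first by apply: leq_trans m1.
      by apply: hY0; rewrite (leq_trans YY0) // (leq_trans YK').
    have h3 : \sum_(K' * Y <= m < 2 * (K' * Y)) m.+1%:R^-1 <= 1 :> R.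
      apply: (le_trans (sum_invS_le _ _)); first by rewrite K'Y leq_pmull.
      rewrite natrM lnM ?posrE ?ltr0n // addrK.
      by rewrite (le_trans (ln_le_subr1 _)) // lerBlDr.
    have ae0 : 0 <= al + eta by rewrite addr_ge0 // ltW.
    have := ler_wpM2l ae0 h3; rewrite mulr1 => h4.
    clear - h1 h2 h4 al11 al0 eta_al bl; lra.
  have [h|h|[z [z1 z2 z3]]] := sign_change (psi_err R) Y (K' * Y).
  - by apply: const; left.
  - by apply: const; right.
  have := @sum_weight_sign_change R al (al + eta) d Y (K * Y)%N z.
  rewrite lnK // (_ : _ - al * d / 6 = b * l); last by rewrite -/s -etal /b; ring.
  apply.
  - by rewrite al0 lerDl ltW.
  - by rewrite d0 d1.
  - by rewrite Yp z1.
  - by rewrite E ltn_pmul2l // ltnW.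
  - by move=> m /andP[m1 _]; apply: hY0; apply: leq_trans m1.
  - by move=> m; apply: hsm => //; apply: leq_trans z1.
have chain := window_chain K1 Y10 b0 (@psi_err_weight_ge0 R) W.
pose C := \sum_(1 <= m < Y1) psi_err_weight R m + b * l + b.
have S0 : 0 <= \sum_(1 <= m < Y1) psi_err_weight R m.
  by apply: sumr_ge0 => m _; exact: psi_err_weight_ge0.
have C0 : 0 <= C by rewrite /C; lra.
have V N : (0 < N)%N -> \sum_(1 <= m < N.+1) psi_err_weight R m <= b * ln N%:R + C.
  move=> N0; have lN := ln_nat_ge0 R N; have blN := mulr_ge0 b0 lN.
  have [h|h] := leqP N.+1 Y1.
    apply: (@le_trans _ _ (\sum_(1 <= m < Y1) psi_err_weight R m)); last by rewrite /C; lra.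
    rewrite (sum_nat_split _ (_ : 1 <= N.+1)%N h) // lerDl.
    by apply: sumr_ge0 => m _; exact: psi_err_weight_ge0.
  rewrite (sum_nat_split _ Y10 (ltnW h)) /C.
  have := chain Y1 N.+1; rewrite leqnn (ltnW h) => /(_ isT).
  have lY := mulr_ge0 b0 (ln_nat_ge0 R Y1).
  have : ln N.+1%:R <= ln N%:R + 1 :> R.
    have := @ln_natS_ub R N N0; have : N%:R^-1 <= 1 :> R by rewrite invf_le1 ?ler1n ?ltr0n.
    by rewrite lerBlDl => h1 h2; rewrite (le_trans h2) // lerD2l.
  move=> /(ler_wpM2l b0); rewrite -/l => h1 h2; clear - h1 h2 lY.
  move: (\sum_(_ <= _ < _) _) (\sum_(_ <= _ < _) _) h2 => s1 s2 h2; lra.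
have D := sum_log_weight b0 C0 V.
(* The average gains [eta]; half of it absorbs the terms of order N ln N once ln N >= T. *)
exists (eta / 2); split; first by clear - eta0 eta_al al0; apply/andP; split; lra.
pose T := Num.max 1 ((2 * C + 3000) * 2 / eta).
have [N0 N00 hN0] := ln_nat_large T.
exists N0 => N hN; have N1 := leq_trans N00 hN.
have := hN0 N hN; rewrite ge_max => /andP[l1 l2].
have := psi_err_log_average R N1; have := D N N1.
rewrite ler_pdivrMr // in l2.
have NR : 0 <= N%:R :> R by [].
have l2' := ler_wpM2r (le_trans ler01 l1) l2.
have l0 : 0 < ln N%:R :> R by apply: lt_le_trans l1.
move=> h1 h2; rewrite -(ler_pM2r (exprn_gt0 2 l0)); apply: le_trans h2 _.
have h3 : 2 * (b / 2 * ln N%:R ^+ 2 + C * ln N%:R) + 1500 * (ln N%:R + 1) <=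
   (al - eta / 2) * ln N%:R ^+ 2.
  exact: aux.
have := ler_wpM2l NR h3; have := ler_wpM2l NR h1.
move: (N%:R : R) (ln _) (\sum_(_ <= _ < _) _); clear => *; lra.
Qed.

(** [inf S] is the limsup of |R(N)|/N; if it were positive, [psi_err_improve] would put a smaller
    number into [S]. *)
Theorem psi_err_little_o (R : realType) (e : R) : 0 < e ->
  exists N0, forall N, (N0 <= N)%N -> `|psi_err R N| <= e * N%:R.
Proof.
move=> e0.
pose S := [set a : R | 0 <= a /\
  exists Y, forall m, (Y <= m)%N -> `|psi_err R m| <= a * m%:R].
have S11 : S 11 by split => //; exists 0%N => m _; exact: psi_err_le.
have Slb : lbound S 0 by move=> a [].
have hS : has_inf S by split; [exists 11 | exists 0].
have inf0 : 0 <= inf S by apply: lb_le_inf => //; exists 11.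
have adh eta : 0 < eta -> exists Y, forall m, (Y <= m)%N ->
     `|psi_err R m| <= (inf S + eta) * m%:R.
  move=> eta0; have [a [a0 [Y hY]] ha] := inf_adherent eta0 hS.
  by exists Y => m hm; rewrite (le_trans (hY _ hm)) // ler_wpM2r // ltW.
have [hle|hlt] := leP (inf S) 0.
  have [Y hY] := adh e e0; exists Y => m /hY h; apply: (le_trans h).
  by rewrite ler_wpM2r // gerDr.
have inf11 : inf S <= 11 by apply: ge_inf => //; exists 0.
have [|c [/andP[c0 cS] [Y hY]]] := psi_err_improve _ adh; first by rewrite hlt inf11.
have : inf S <= inf S - c.
  apply: ge_inf; first by exists 0.
  by split; [rewrite subr_ge0 ltW | exists Y].
by rewrite lerBrDl gerDr leNgt c0.
Qed.

(** * From [psi] to [theta] *)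

Definition theta (R : realType) (N : nat) : R :=
  \sum_(1 <= p < N.+1 | prime p) ln p%:R.

Lemma psi_trunc_log (R : realType) (N : nat) :
  psi R N = \sum_(1 <= p < N.+1 | prime p) ln p%:R *+ trunc_log p N.
Proof.
case: (posnP N) => [->|N0]; first by rewrite /psi !big_geq.
transitivity (\sum_(1 <= n < N.+1)
  \sum_(1 <= p < N.+1 | prime p) \sum_(1 <= a < N.+1 | (p ^ a == n)%N) (ln p%:R : R)).
  rewrite /psi big_nat [RHS]big_nat; apply: eq_bigr => n hn; exact: vonMangoldt_widen.
rewrite (exchange_big_dep_nat (fun p => prime p)) //=; apply: eq_bigr => p pp.
rewrite (exchange_big_dep_nat xpredT) //=.
have tN : (trunc_log p N <= N)%N.
  have := trunc_logP (prime_gt1 pp) N0; apply: leq_trans.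
  by rewrite ltnW // ltn_expl // prime_gt1.
rewrite -(sum_nat_const_le _ tN) [RHS]big_mkcond /=.
apply: eq_bigr => a _.
under eq_bigl do rewrite eq_sym.
rewrite pp /= big_nat1_eq expn_gt0 prime_gt0 //= ltnS.
congr (if _ then _ else _); apply/idP/idP => [|h]; first exact: (trunc_log_max (prime_gt1 pp)).
by rewrite (leq_trans _ (trunc_logP (prime_gt1 pp) N0)) // leq_pexp2l // prime_gt0.
Qed.

Lemma trunc_log_ln (R : realType) (p N : nat) : prime p -> (0 < N)%N ->
  ln p%:R *+ trunc_log p N <= ln N%:R :> R.
Proof.
move=> pp N0; rewrite -lnXn ?ltr0n ?prime_gt0 // -natrX.
have hp : (0 < p ^ trunc_log p N)%N by rewrite expn_gt0 prime_gt0.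
by rewrite ler_ln ?posrE ?ltr0n // ler_nat trunc_logP // prime_gt1.
Qed.

Lemma theta_le_psi (R : realType) (N : nat) : theta R N <= psi R N.
Proof.
rewrite psi_trunc_log /theta big_nat_cond [leRHS]big_nat_cond.
apply: ler_sum => p /andP[/andP[p0 pN] pp].
have : (0 < trunc_log p N)%N by apply: trunc_log_max (prime_gt1 pp) _; rewrite expn1.
by case: (trunc_log p N) => // k _; rewrite mulrS lerDl mulrn_wge0 // ln_nat_ge0.
Qed.

(** Only primes p <= sqrt N have a square up to N, and each prime contributes at most ln N to
    psi. *)
Lemma psi_sub_theta (R : realType) (N : nat) : (0 < N)%N ->
  psi R N - theta R N <= Num.sqrt N%:R * ln N%:R.
Proof.
move=> N0; rewrite psi_trunc_log /theta -sumrB.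
pose s := Num.truncn (Num.sqrt N%:R : R).
have sN : (s <= N)%N.
  rewrite -(ler_nat R) (@le_trans _ _ (Num.sqrt N%:R)) ?truncn_le ?sqrtr_ge0 //.
  have h1 : 1 <= Num.sqrt N%:R :> R by rewrite -[leLHS]sqrtr1 ler_wsqrtr // ler1n.
  by rewrite -[leRHS]sqr_sqrtr // expr2 ler_peMl // sqrtr_ge0.
have hs : s%:R <= Num.sqrt N%:R :> R by rewrite truncn_le sqrtr_ge0.
apply: (@le_trans _ _ (\sum_(1 <= p < N.+1 | (p <= s)%N) ln N%:R)); last first.
  by rewrite sum_nat_const_le // -[ln _ *+ s]mulr_natl ler_wpM2r // ln_nat_ge0.
rewrite big_mkcond [leRHS]big_mkcond /=; apply: ler_sum_nat => p /andP[p0 pN].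
case: (boolP (prime p)) => pp; last by case: ifP => // _; exact: ln_nat_ge0.
have h := trunc_log_ln R pp N0; have lp := ln_nat_ge0 R p.
case: leqP => ps; first by rewrite (le_trans _ h) // gerBl.
have -> : trunc_log p N = 1%N.
  have p1 := prime_gt1 pp; apply/eqP; rewrite eqn_leq (trunc_log_max p1) ?andbT; last first.
    by rewrite expn1 -ltnS.
  rewrite leqNgt; apply/negP => h2.
  have : (p ^ 2 <= N)%N.
    by rewrite (leq_trans _ (trunc_logP p1 N0)) // leq_pexp2l.
  rewrite -(ler_nat R) natrX => /ler_wsqrtr; rewrite sqrtr_sqr ger0_norm //.
  by rewrite -truncn_ge_nat ?sqrtr_ge0 // leqNgt ps.
by rewrite mulr1n subrr.
Qed.

Lemma theta_asymptotic (R : realType) (e : R) : 0 < e ->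
  exists X, forall x, X <= x -> `|theta R (Num.truncn x) - x| <= e * x.
Proof.
move=> e0; have e3 : 0 < e / 3 by rewrite divr_gt0.
have [N1 hN1] := psi_err_little_o e3.
(* One third of the error each: for [psi_err], for x - [x] <= 1, and for the prime powers. *)
pose X : R := Num.max (Num.max N1.+1%:R (3 / e)) ((12 / e) ^+ 4).
exists X => x; rewrite !ge_max => /andP[/andP[x1 x2] x3].
have x0 : 0 <= x by rewrite (le_trans _ x1).
set N := Num.truncn x.
have /andP[Nx xN] := truncn_itv x0; rewrite -/N in Nx xN.
have N1N : (N1 < N)%N by rewrite /N truncn_gt_nat.
have N0 : (0 < N)%N by apply: leq_trans N1N.
have h1 := hN1 N (ltnW N1N).
have h2 := theta_le_psi R N; have h3 := psi_sub_theta R N0.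
have ex : 1 <= e / 3 * x by rewrite -ler_pdivrMl // mulr1 invf_div.
(* With r the fourth root of N, ln N = 4 ln r <= 4 r, so sqrt N ln N <= 4 r^3 = o(N). *)
pose r := Num.sqrt (Num.sqrt N%:R : R).
have r0 : 0 < r by rewrite !sqrtr_gt0 ltr0n.
have r2 : r ^+ 2 = Num.sqrt N%:R by rewrite sqr_sqrtr // sqrtr_ge0.
have r4 : r ^+ 4 = N%:R by rewrite (exprM r 2 2) r2 sqr_sqrtr.
have h4 : Num.sqrt N%:R * ln N%:R <= 4 * r ^+ 3.
  rewrite -r2 -r4 lnXn // -[ln r *+ 4]mulr_natl (_ : 4 * r ^+ 3 = r ^+ 2 * (4 * r)); last by ring.
  rewrite ler_wpM2l ?exprn_ge0 ?(ltW r0) // ler_wpM2l //.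
  by rewrite (le_trans (ln_le_subr1 _)) // gerBl.
pose y := Num.sqrt (Num.sqrt x).
have y0 : 0 <= y by rewrite sqrtr_ge0.
have y4 : y ^+ 4 = x by rewrite (exprM y 2 2) !sqr_sqrtr // sqrtr_ge0.
have ry : r <= y by rewrite !ler_wsqrtr.
have ye : 12 / e <= y.
  by rewrite -(@ler_pXn2r _ 4) ?nnegrE ?divr_ge0 ?(ltW e0) // y4.
have h5 : 4 * r ^+ 3 <= e / 3 * x.
  apply: (@le_trans _ _ (4 * y ^+ 3)).
    by rewrite ler_wpM2l // lerXn2r ?nnegrE // ltW.
  rewrite -y4 [y ^+ 4]exprS [leRHS]mulrA ler_wpM2r ?exprn_ge0 //.
  by rewrite -ler_pdivrMl // (_ : _^-1 * 4 = 12 / e) //; field; rewrite gt_eqF.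
have h6 : e / 3 * N%:R <= e / 3 * x by rewrite ler_wpM2l // ltW.
have xN' : x <= N%:R + 1 by rewrite natr1 ltW.
move: h1; rewrite /psi_err !ler_norml.
clear - h2 h3 h4 h5 h6 ex Nx xN'.
move: (theta R N) (psi R N) (N%:R : R) (_ * ln _) (r ^+ 3) h2 h3 h4 h5 h6 Nx xN' => *.
lra.
Qed.

(** * Slow variation *)

(* The closed sets [E n] of the shifts [t] that are good from [n] on cover the
   line, so by Baire one of them contains an interval. *)
Lemma uniform_slow_variation (R : realType) (F : R -> R) : continuous F ->
  (forall t e, 0 < e -> exists U, forall u, U <= u -> `|F (u + t) - F u| <= e) ->
  forall T e, 0 < e -> exists U, forall u t, U <= u -> 0 <= t <= T ->
    `|F (u + t) - F u| <= e.
Proof.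
move=> cF hF T e e0; have e3 : 0 < e / 3 by rewrite divr_gt0.
pose E (n : nat) := \bigcap_(u in [set u : R | n%:R <= u])
   [set t : R | `|F (u + t) - F u| <= e / 3].
have Ecl n : closed (E n).
  apply: closed_bigI => u _.
  apply: (@preimage_closed _ _ (fun t => `|F (u + t) - F u|) [set x | x <= e / 3]); last exact: closed_le.
  move=> t _.
  apply: (@continuous_comp _ _ _ (fun t => F (u + t) - F u) (fun x => `|x|)); last exact: norm_continuous.
  apply: continuousB; last exact: cst_continuous.
  apply: (@continuous_comp _ _ _ (fun t => u + t) F); last exact: cF.
  by apply: continuousD; [exact: cst_continuous | exact: cvg_id].
have [n [t0 [r r0 hr]]] : exists n t0, exists2 r : R, 0 < r &
    forall t, `|t - t0| < r -> E n t.
  (* If no [E n] had interior, the complements would be open and dense, and Baire would give a shift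
     [a] outside all of them, against [hF a]. *)
  apply: contrapT => hno.
  have [a [_ ha]] : exists a, ([set: R] `&` \bigcap_n ~` (E n)) a.
    apply: (@Baire R R (fun n => ~` E n)); last 2 first.
    - by exists 0.
    - exact: openT.
    move=> n; split; first by rewrite openC.
    move=> O [t Ot] /(_ t Ot) /nbhs_ballP[r /= r0 hr].
    apply: contrapT => hO; apply: hno; exists n, t, r => // s hs.
    apply: contrapT => hs2; apply: hO; exists s; split => //.
    by apply: hr; rewrite /ball /= distrC.
  have [U hU] := hF a (e / 3) e3.
  pose n := (Num.truncn U).+1.
  have := ha n I; apply => u /= hu; apply: hU.
  by rewrite (le_trans (ltW (truncnS_gt _)) hu).
(* Both values are compared with F(u - t0): the shifts t0 and s + t0 lie in the good interval. *)
have small u s : n%:R + t0 <= u -> 0 <= s < r -> `|F (u + s) - F u| <= 2 * (e / 3).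
  move=> hu /andP[s0 sr].
  have hu' : n%:R <= u - t0 by rewrite lerBrDr.
  have h1 : E n t0 by apply: hr; rewrite subrr normr0.
  have := h1 _ hu' => /=; rewrite subrK => k1.
  have h2 : E n (s + t0) by apply: hr; rewrite addrK ger0_norm.
  have := h2 _ hu' => /=; rewrite [s + t0]addrC addrA subrK => k2.
  rewrite (_ : _ - F u = (F (u + s) - F (u - t0)) - (F u - F (u - t0))); last by ring.
  by apply: (le_trans (ler_normB _ _)); rewrite mulr2n mulrDl mul1r lerD.
(* Errors do not accumulate along j: [hF] at the single shift j r/2 costs e/3, and the remaining
   shift, at most r/2 < r, costs 2 e/3. *)
have step j : exists U, forall u t, U <= u -> 0 <= t <= j%:R * (r / 2) ->
    `|F (u + t) - F u| <= e.
  elim: j => [|j [U IH]].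
    exists 0 => u t _; rewrite mul0r -eq_le => /eqP <-.
    by rewrite addr0 subrr normr0 ltW.
  have [V hV] := hF (j%:R * (r / 2)) (e / 3) e3.
  have jr : 0 <= j%:R * (r / 2) by rewrite mulr_ge0 // divr_ge0 // ltW.
  exists (Num.max U (Num.max V (n%:R + t0))) => u t.
  rewrite !ge_max => /and3P[u1 u2 u3] /andP[t1 t2].
  have [h|h] := leP t (j%:R * (r / 2)); first by apply: IH => //; rewrite t1.
  have hs : 0 <= t - j%:R * (r / 2) < r.
    rewrite subr_ge0 ltW //= ltrBlDr (le_lt_trans t2) // -natr1 mulrDl mul1r addrC ltrD2r.
    by rewrite ltr_pdivrMr // ltr_pMr // ltr1n.
  have hu : n%:R + t0 <= u + j%:R * (r / 2) by rewrite (le_trans u3) // lerDl.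
  have k1 := small _ _ hu hs; have k2 := hV u u2.
  rewrite addrACA subrr addr0 in k1.
  rewrite (_ : _ - F u = (F (u + t) - F (u + j%:R * (r / 2))) + (F (u + j%:R * (r / 2)) - F u)); last by ring.
  apply: (le_trans (ler_normD _ _)); rewrite (_ : e = 2 * (e / 3) + e / 3); last by field.
  exact: lerD.
have [U hU] := step (Num.truncn (T / (r / 2))).+1.
exists U => u t hu /andP[t1 t2]; apply: hU => //; rewrite t1 (le_trans t2) //.
by rewrite -ler_pdivrMr ?divr_gt0 // ltW // truncnS_gt.
Qed.

Lemma slowly_varying_uniform (R : realType) (L : R -> R) : slowly_varying L ->
  forall T e, 0 < e -> exists2 X, 2 <= X & forall x y, X <= x -> x <= y <= T * x ->
    L x <= (1 + e) * L y /\ L y <= (1 + e) * L x.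
Proof.
move=> [Lpos Lcont Llim] T e e0.
(* a continuous function with values in [2, +oo[ that agrees with [expR] where expR u >= 2 *)
pose ext (u : R) : R := `|expR u - 2| + 2.
have ext2 u : 2 <= ext u by rewrite /ext lerDr.
have extE u : 2 <= expR u -> ext u = expR u.
  by move=> h; rewrite /ext ger0_norm ?subr_ge0 // subrK.
pose F u := ln (L (ext u)).
have extc : continuous ext.
  move=> u; apply: cvgD; last exact: cvg_cst.
  by apply: cvg_norm; apply: cvgB; [exact: continuous_expR | exact: cvg_cst].
have cF : continuous F.
  move=> u; apply: (@continuous_comp _ _ _ (fun u => L (ext u)) (@ln R)); last first.
    by apply: continuous_ln; exact: Lpos.
  (* L is only continuous within [2, +oo[, but [ext] takes all its values there. *)
  apply: (@cvg_comp _ _ _ ext L _ (within `[2, +oo[%classic (nbhs (ext u)))).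
    move=> P /= hP; have h := extc u _ hP.
    apply: (@filterS _ (nbhs u) _ (fun v => ext v \in `[2, +oo[ -> P (ext v))) => //.
    by move=> v; apply; rewrite in_itv /= andbT.
  have /subspace_continuousP := Lcont; apply.
  by rewrite /= in_itv /= andbT.
have l1e : 0 < ln (1 + e) by rewrite ln_gt0 // ltrDl.
have hF t d : 0 < d -> exists U, forall u, U <= u -> `|F (u + t) - F u| <= d.
  move=> d0; have := Llim (expR t) (expR_gt0 t) => h.
  have {}h : ln (L (expR t * x) / L x) @[x --> +oo] --> (ln 1 : R).
    by apply: (continuous_cvg _ _ h); apply: continuous_ln.
  have [M [_ hM]] := cvgr_dist_le _ _ h _ d0.
  (* expR V is max 2 (M + 1): the limit at +oo speaks of arguments strictly above M. *)
  pose V := ln (Num.max 2 (M + 1)).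
  exists (Num.max V (V - t)) => u; rewrite ge_max => /andP[h1 h2].
  have big v : V <= v -> 2 <= expR v /\ M < expR v.
    move=> hv; have : expR V <= expR v by rewrite ler_expR.
    rewrite /V lnK; last by rewrite posrE lt_max ltr0n.
    by rewrite ge_max => /andP[-> k]; split => //; apply: lt_le_trans k; rewrite ltrDl.
  have [u1 u2] := big u h1.
  have hut : V <= u + t by rewrite -lerBlDr.
  have [u3 u4] := big (u + t) hut.
  rewrite /F !extE // -ln_div ?posrE ?Lpos // expRD [expR u * _]mulrC.
  by have := hM _ u2; rewrite ln1 sub0r normrN.
have [U hU] := @uniform_slow_variation R F cF hF (ln T) (ln (1 + e)) l1e.
exists (Num.max 2 (expR U)); first by rewrite le_max lexx.
move=> x y; rewrite ge_max => /andP[x2 xU] /andP[xy yT].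
have x0 : 0 < x by apply: lt_le_trans x2.
have y0 : 0 < y by apply: lt_le_trans xy.
have y2 : 2 <= y by apply: le_trans xy.
have T0 : 0 < T by rewrite -(pmulr_lgt0 _ x0) (lt_le_trans y0).
have := hU (ln x) (ln (y / x)).
rewrite -[U]expRK ler_ln ?posrE ?expR_gt0 // => /(_ xU).
rewrite ln_ge0 ?ler_pdivlMr ?mul1r // ler_ln ?posrE ?divr_gt0 // ler_pdivrMr // yT => /(_ isT).
rewrite -lnM ?posrE ?divr_gt0 // mulrCA divff ?gt_eqF // mulr1.
rewrite /F !extE ?lnK ?posrE //.
have Lx := Lpos x x2; have Ly := Lpos y y2.
rewrite ler_norml lerBlDr => /andP[].
rewrite lerBrDr addrC lerBlDr -!lnM ?posrE ?addr_gt0 //.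
have e1 : 0 < 1 + e by rewrite addr_gt0.
by rewrite !ler_ln ?posrE ?mulr_gt0 // [L y * _]mulrC.
Qed.

(** The logarithm also varies slowly: ln y <= ln T + ln x <= (1 + d) ln x once ln x >= ln T / d. *)
Lemma slowly_varying_div_ln_uniform (R : realType) (L : R -> R) : slowly_varying L ->
  forall T e, 0 < e -> exists2 X, 2 <= X & forall x y, X <= x -> x <= y <= T * x ->
    L x / ln x <= (1 + e) * (L y / ln y) /\ L y / ln y <= (1 + e) * (L x / ln x).
Proof.
move=> hL T e e0; have [Lpos _ _] := hL.
pose d := Num.min 1 (e / 3).
have d0 : 0 < d by rewrite lt_min ltr01 divr_gt0.
have dd : (1 + d) * (1 + d) <= 1 + e.
  have d1 : d <= 1 by rewrite ge_min lexx.
  have d3 : d <= e / 3 by rewrite ge_min lexx orbT.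
  have : d * d <= d by rewrite ler_piMl // ltW.
  by lra.
have [X X2 hX] := slowly_varying_uniform hL T d0.
exists (Num.max X (expR (ln T / d))); first by rewrite le_max X2.
move=> x y; rewrite ge_max => /andP[x1 x3] hxy; have /andP[xy yT] := hxy.
have x2 := le_trans X2 x1; have y2 := le_trans x2 xy.
have x0 : 0 < x by apply: lt_le_trans x2.
have y0 : 0 < y by apply: lt_le_trans y2.
have T0 : 0 < T by rewrite -(pmulr_lgt0 _ x0) (lt_le_trans y0).
have lx : 0 < ln x by rewrite ln_gt0 // (lt_le_trans _ x2) // ltr1n.
have ly : 0 < ln y by rewrite ln_gt0 // (lt_le_trans _ y2) // ltr1n.
have lxy : ln x <= ln y by rewrite ler_ln.
have lyx : ln y <= (1 + d) * ln x.
  rewrite mulrDl mul1r (@le_trans _ _ (ln T + ln x)) //.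
    by rewrite -lnM ?posrE // ler_ln ?posrE // mulr_gt0.
  by rewrite addrC lerD2l mulrC -ler_pdivrMr // -[leLHS]expRK ler_ln ?posrE ?expR_gt0.
have [h1 h2] := hX x y x1 hxy; have Lx := Lpos x x2; have Ly := Lpos y y2.
have dle : 1 + d <= 1 + e.
  by apply: le_trans dd; rewrite ler_peMl // ?addr_ge0 ?lerDl // ltW.
have d1 : 0 < 1 + d by rewrite addr_gt0.
split.
  rewrite mulrA ler_pdivlMr // mulrAC ler_pdivrMr //.
  apply: (@le_trans _ _ ((1 + d) * L y * ((1 + d) * ln x))).
    by apply: ler_pM => //; exact: ltW.
  by rewrite mulrACA mulrA ler_wpM2r ?(ltW lx) // ler_wpM2r // ltW.
rewrite mulrA ler_pdivlMr // mulrAC ler_pdivrMr //.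
apply: ler_pM => //; try exact: ltW.
by apply: (le_trans h2); rewrite ler_wpM2r // ltW.
Qed.

(** * Sums of p^(s-1) L(p) over primes *)

(** Only upper bounds are asserted, so it serves both t - u and c - t. The number of steps from y
    down to the starting interval depends on y; therefore T is first bounded by a constant, and then
    a fixed number k of contractions is applied. *)
Lemma contraction_small (R : realType) (T : R -> R) (q al Y0 B : R) :
  0 < q < 1 -> 0 <= al < 1 -> 0 < Y0 ->
  (forall y, Y0 <= y -> T y <= al * T (q * y)) ->
  (forall y, q * Y0 <= y <= Y0 -> T y <= B) ->
  forall e, 0 < e -> exists Y, forall y, Y <= y -> T y <= e.
Proof.
move=> /andP[q0 q1] /andP[al0 al1] Y00 hT hB' e e0.
(* Nonnegativity of [C] ensures al C <= C. *)
pose C := Num.max B 0.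
have C0 : 0 <= C by rewrite le_max lexx orbT.
have hB y : q * Y0 <= y <= Y0 -> T y <= C by move=> /hB' h; rewrite le_max h.
have q0' : q != 0 by rewrite gt_eqF.
have all_bound n y : q * Y0 <= y -> q ^+ n * y <= Y0 -> T y <= C.
  elim: n y => [|n IH] y hy1 hy2; first by apply: hB; rewrite hy1 -[y]mul1r -(expr0 q).
  have [h|h] := leP y Y0; first by apply: hB; rewrite hy1.
  apply: (le_trans (hT _ (ltW h))); apply: (@le_trans _ _ (al * C)).
    rewrite ler_wpM2l // IH //; first by rewrite ler_pM2l // ltW.
    by rewrite mulrA -exprSr.
  by rewrite ler_piMl // ltW.
have bound y : q * Y0 <= y -> T y <= C.
  move=> hy.
  have y0 : 0 < y by apply: lt_le_trans hy; rewrite mulr_gt0.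
  have : (GRing.exp q : R^nat) x @[x --> \oo] --> (0 : R).
    by apply: cvg_expr; rewrite ger0_norm // ltW.
  move=> /cvgr_dist_le /(_ (Y0 / y) (divr_gt0 Y00 y0)) [n _ hn].
  have := hn n (leqnn n); rewrite /= sub0r normrN ger0_norm ?exprn_ge0 ?(ltW q0) //.
  by rewrite ler_pdivlMr //; exact: all_bound.
have geom k y : q * Y0 <= q ^+ k * y -> T y <= al ^+ k * C.
  elim: k y => [|k IH] y hy; first by rewrite mul1r; apply: bound; rewrite -[y]mul1r -(expr0 q).
  have hy' : Y0 <= q ^+ k * y by move: hy; rewrite exprS -mulrA ler_pM2l.
  have y0 : 0 < y by rewrite -(pmulr_rgt0 _ (exprn_gt0 k q0)) (lt_le_trans Y00).
  have yY : Y0 <= y.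
    by apply: le_trans hy' _; rewrite ler_piMl ?(ltW y0) // exprn_ile1 ?ltW.
  apply: (le_trans (hT _ yY)); rewrite exprS -mulrA ler_wpM2l // IH //.
  by rewrite mulrA -exprSr.
have : (GRing.exp al : R^nat) x @[x --> \oo] --> (0 : R).
  by apply: cvg_expr; rewrite ger0_norm.
have eC : 0 < e / (C + 1) by rewrite divr_gt0 // ltr_wpDl.
move=> /cvgr_dist_le /(_ _ eC) [k _ hk].
have := hk k (leqnn k); rewrite /= sub0r normrN ger0_norm ?exprn_ge0 // => hk'.
exists (q * Y0 / q ^+ k) => y hy.
apply: (le_trans (geom k y _)); first by rewrite [leRHS]mulrC -ler_pdivrMr ?exprn_gt0.
apply: (le_trans (ler_wpM2r C0 hk')); rewrite mulrAC ler_pdivrMr ?ltr_wpDl //.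
by rewrite ler_pM2l // lerDl.
Qed.

(** Indexed by its order of growth s: s = rho + 1 gives the sum of h(p), s = rho the error from
    small primes. *)
Definition primesum (R : realType) (L : R -> R) (s y : R) : R :=
  \sum_(1 <= p < (Num.truncn y).+1 | prime p) p%:R `^ s / p%:R * L p%:R.

Definition gauge (R : realType) (L : R -> R) (s y : R) : R :=
  y `^ s * (L y / ln y).

Lemma gauge_gt0 (R : realType) (L : R -> R) (s y : R) : slowly_varying L ->
  2 <= y -> 0 < gauge L s y.
Proof.
move=> [Lpos _ _] y2; rewrite mulr_gt0 ?powR_gt0 ?(lt_le_trans _ y2) // divr_gt0 ?Lpos //.
by rewrite ln_gt0 // (lt_le_trans _ y2) // ltr1n.
Qed.

Lemma primesum_term_ge0 (R : realType) (L : R -> R) (s : R) (p : nat) :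
  slowly_varying L -> prime p -> 0 <= p%:R `^ s / p%:R * L p%:R.
Proof.
move=> [Lpos _ _] pp; rewrite mulr_ge0 ?divr_ge0 ?powR_ge0 // ltW // Lpos //.
by rewrite ler_nat prime_gt1.
Qed.

Lemma primesum_le (R : realType) (L : R -> R) (s y z : R) : slowly_varying L ->
  y <= z -> primesum L s y <= primesum L s z.
Proof.
move=> hL yz; rewrite /primesum [leRHS](big_cat_nat (n := (Num.truncn y).+1)) //=; last first.
  by rewrite ltnS le_truncn.
by rewrite lerDl; apply: sumr_ge0 => p pp; exact: primesum_term_ge0.
Qed.

Lemma primesum_ge0 (R : realType) (L : R -> R) (s y : R) : slowly_varying L ->
  0 <= primesum L s y.
Proof. by move=> hL; apply: sumr_ge0 => p pp; exact: primesum_term_ge0. Qed.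

(** z^s and 1/z are estimated separately because s - 1 may be negative. *)
Lemma powR_div_nat_bounds (R : realType) (s q y z : R) : 0 <= s -> 0 < q -> 0 < y ->
  q * y <= z <= y ->
  q `^ s * y `^ s / y <= z `^ s / z <= y `^ s / (q * y).
Proof.
move=> s0 q0 y0 /andP[h1 h2].
have qy0 : 0 < q * y by rewrite mulr_gt0.
have z0 : 0 < z by apply: lt_le_trans h1.
rewrite -powRM ?(ltW q0) ?(ltW y0) //; apply/andP; split.
  apply: ler_pM; rewrite ?powR_ge0 ?invr_ge0 ?(ltW y0) //.
    by rewrite ge0_ler_powR // nnegrE ltW.
  by rewrite lef_pV2 ?posrE.
apply: ler_pM; rewrite ?powR_ge0 ?invr_ge0 ?(ltW z0) //.
  by rewrite ge0_ler_powR // nnegrE ltW.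
by rewrite lef_pV2 ?posrE.
Qed.

(** For p in (q y, y] the quotient L(p)/ln p is nearly L(y)/ln y and p^s/p nearly y^s/y; what
    remains is the sum of ln p, which is (1 - q) y up to 2 e y by the prime number theorem. *)
Lemma primesum_block (R : realType) (L : R -> R) (s q e : R) :
  slowly_varying L -> 0 < s -> 0 < q < 1 -> 0 < e ->
  exists2 X, 2 <= X & forall y, X <= q * y ->
    [/\ primesum L s y - primesum L s (q * y) <= (1 + e) / q * (1 - q + 2 * e) * gauge L s y,
        q `^ s / (1 + e) * (1 - q - 2 * e) * gauge L s y <=
          primesum L s y - primesum L s (q * y),
        gauge L s (q * y) <= q `^ s * (1 + e) * gauge L s y &
        q `^ s / (1 + e) * gauge L s y <= gauge L s (q * y)].
Proof.
move=> hL s0 /andP[q0 q1] e0; have [Lpos _ _] := hL.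
have [X1 X12 hX1] := slowly_varying_div_ln_uniform hL q^-1 e0.
have [X2 hX2] := theta_asymptotic e0.
exists (Num.max X1 X2); first by rewrite le_max X12.
move=> y; rewrite ge_max => /andP[y1 y2].
have qy2 : 2 <= q * y by apply: le_trans y1.
have qy0 : 0 < q * y by apply: lt_le_trans qy2.
have y0 : 0 < y by rewrite -(pmulr_rgt0 _ q0).
have qyy : q * y <= y by rewrite ler_piMl ?ltW.
have e1 : 0 < 1 + e by rewrite addr_gt0.
have ly0 : 0 < ln y by rewrite ln_gt0 // (lt_le_trans _ qyy) // (lt_le_trans _ qy2) // ltr1n.
have l0 : 0 <= L y / ln y by rewrite divr_ge0 ?ltW // Lpos // (le_trans qy2).
have hl z : q * y <= z <= y ->
   L z / ln z <= (1 + e) * (L y / ln y) /\ L y / ln y <= (1 + e) * (L z / ln z).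
  move=> /andP[h1 h2]; apply: hX1; first by apply: le_trans h1.
  by rewrite h2 /= mulrC ler_pdivlMr // mulrC.
have hth : `|(theta R (Num.truncn y) - theta R (Num.truncn (q * y))) - (y - q * y)| <= 2 * e * y.
  have h1 := hX2 y (le_trans y2 qyy); have h2 := hX2 _ y2.
  have h3 : e * (q * y) <= e * y by rewrite ler_wpM2l // ltW.
  rewrite (_ : _ - _ - (y - q * y) = (theta R (Num.truncn y) - y) - (theta R (Num.truncn (q * y)) - q * y)); last by ring.
  by apply: le_trans (ler_normB _ _) _; lra.
set m := (Num.truncn (q * y)).+1; set n := (Num.truncn y).+1.
have mn : (m <= n)%N by rewrite ltnS le_truncn.
have m1 : (1 <= m)%N by [].
have split (f : nat -> R) : \sum_(1 <= p < n | prime p) f p - \sum_(1 <= p < m | prime p) f p =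
    \sum_(m <= p < n | prime p) f p.
  by rewrite (big_cat_nat m1 mn) /= addrAC subrr add0r.
rewrite /primesum split; move: hth; rewrite /theta split -/m -/n => hth.
set th := \sum_(m <= p < n | prime p) ln p%:R in hth.
have range p : (m <= p < n)%N -> q * y <= p%:R <= y.
  move=> /andP[h1 h2]; apply/andP; split.
    by rewrite (le_trans (ltW (truncnS_gt _))) // ler_nat.
  by rewrite -truncn_ge_nat ?(ltW y0).
have th_ub : th <= (1 - q + 2 * e) * y by move: hth; rewrite ler_norml; lra.
have th_lb : (1 - q - 2 * e) * y <= th by move: hth; rewrite ler_norml; lra.
have term p : (m <= p < n)%N -> prime p ->
   p%:R `^ s / p%:R * L p%:R = p%:R `^ s / p%:R * (L p%:R / ln p%:R) * ln p%:R.
  move=> _ pp; rewrite -!mulrA mulVf ?mulr1 // gt_eqF // ln_gt0 // ltr1n prime_gt1 //.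
have y0' : y != 0 by rewrite gt_eqF.
have q0' : q != 0 by rewrite gt_eqF.
have ys0 : 0 <= y `^ s := powR_ge0 _ _.
split.
- apply: (@le_trans _ _ (y `^ s / (q * y) * ((1 + e) * (L y / ln y)) * th)).
    rewrite /th mulr_sumr big_nat_cond [leRHS]big_nat_cond; apply: ler_sum => p /andP[hp pp].
    rewrite (term p hp pp) ler_wpM2r ?ln_nat_ge0 //.
    have /andP[_ h1] := powR_div_nat_bounds (ltW s0) q0 y0 (range p hp).
    have [h2 _] := hl _ (range p hp).
    apply: ler_pM => //.
    by rewrite divr_ge0 ?ln_nat_ge0 // ltW // Lpos // ler_nat prime_gt1.
  have h := ler_wpM2l (_ : 0 <= y `^ s / (q * y) * ((1 + e) * (L y / ln y))) th_ub.
  apply: (le_trans (h _)).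
    by rewrite mulr_ge0 ?divr_ge0 ?(ltW qy0) // mulr_ge0 // ltW.
  rewrite /gauge le_eqVlt; apply/orP; left; apply/eqP.
  by field; rewrite (gt_eqF ly0) y0' q0'.
- apply: (@le_trans _ _ (q `^ s * y `^ s / y * ((1 + e)^-1 * (L y / ln y)) * th)).
    have h := ler_wpM2l (_ : 0 <= q `^ s * y `^ s / y * ((1 + e)^-1 * (L y / ln y))) th_lb.
    apply: (le_trans _ (h _)); last first.
      by rewrite mulr_ge0 ?divr_ge0 ?(ltW y0) // mulr_ge0 ?powR_ge0 // invr_ge0 ltW.
    rewrite /gauge le_eqVlt; apply/orP; left; apply/eqP.
    by field; rewrite (gt_eqF ly0) y0' gt_eqF.
  rewrite /th mulr_sumr big_nat_cond [leRHS]big_nat_cond; apply: ler_sum => p /andP[hp pp].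
  rewrite (term p hp pp) ler_wpM2r ?ln_nat_ge0 //.
  have /andP[h1 _] := powR_div_nat_bounds (ltW s0) q0 y0 (range p hp).
  have [_ h2] := hl _ (range p hp).
  apply: ler_pM => //.
  + by rewrite divr_ge0 ?(ltW y0) // mulr_ge0 ?powR_ge0.
  + by rewrite mulr_ge0 // invr_ge0 ltW.
  + by rewrite ler_pdivrMl.
- have hqq : q * y <= q * y <= y by rewrite lexx.
  have [h _] := hl _ hqq.
  rewrite /gauge powRM ?(ltW q0) ?(ltW y0) //.
  rewrite [leRHS](_ : _ = q `^ s * y `^ s * ((1 + e) * (L y / ln y))); last by ring.
  by rewrite ler_wpM2l // mulr_ge0 ?powR_ge0.
- have hqq : q * y <= q * y <= y by rewrite lexx.
  have [_ h] := hl _ hqq.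
  rewrite /gauge powRM ?(ltW q0) ?(ltW y0) //.
  rewrite [leLHS](_ : _ = q `^ s * y `^ s * ((1 + e)^-1 * (L y / ln y))); last by ring.
  by rewrite ler_wpM2l ?mulr_ge0 ?powR_ge0 // ler_pdivrMl.
Qed.

Lemma powR_1B_bounds (R : realType) (s h : R) : 0 < s -> 0 < h < 1 ->
  1 - s * h / (1 - h) <= (1 - h) `^ s <= (1 + s * h)^-1.
Proof.
move=> s0 /andP[h0 h1]; have q0 : 0 < 1 - h by rewrite subr_gt0.
rewrite /powR gt_eqF //; apply/andP; split.
  apply: le_trans (expR_ge1Dx _); rewrite lerD2l.
  have := ln_ge_1Binv q0; have -> : 1 - (1 - h)^-1 = - (h / (1 - h)).
    by field; rewrite gt_eqF.
  by move=> /(ler_wpM2l (ltW s0)); rewrite mulrN mulrA.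
have l : ln (1 - h) <= - h by rewrite (le_trans (ln_le_subr1 q0)) // addrAC subrr add0r.
have sh : 0 < 1 + s * h by rewrite addr_gt0 // mulr_gt0.
rewrite -(ler_pM2r sh) mulVf ?gt_eqF //.
apply: (@le_trans _ _ (expR (s * ln (1 - h)) * expR (s * h))).
  by rewrite ler_wpM2l ?expR_ge0 // expR_ge1Dx.
rewrite -expRD -mulrDr -[leRHS]expR0 ler_expR mulr_ge0_le0 ?(ltW s0) //.
by rewrite -lerBrDr sub0r.
Qed.

(** For u slightly above 1/s, [key] says that the increment of a block is at most u (1 - al), so t -
    u contracts. The other half of d is spent on the limit. *)
Lemma primesum_upper (R : realType) (L : R -> R) (s d : R) :
  slowly_varying L -> 0 < s -> 0 < d ->
  exists2 X, 2 <= X & forall y, X <= y -> primesum L s y <= (s^-1 + d) * gauge L s y.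
Proof.
move=> hL s0 d0; pose u := s^-1 + d / 2.
have u0 : 0 < u by rewrite addr_gt0 ?invr_gt0 // divr_gt0.
have us : u * s = 1 + d / 2 * s by rewrite /u mulrDl mulVf ?gt_eqF.
(* [K] collects the coefficients of h in [key]: 1 + (5 + 6 s) h <= u s - h u (1 + s) follows from h
   K <= d s / 2 = u s - 1. *)
pose K := 5 + 6 * s + u * (1 + s).
have K0 : 0 < K by have := mulr_gt0 u0 s0; rewrite /K; clear - s0 u0; lra.
pose h := Num.min (Num.min 2^-1 (s / 2)) (d / 2 * s / K).
have h0 : 0 < h by rewrite !lt_min invr_gt0 ltr0n !divr_gt0 ?mulr_gt0 // divr_gt0.
have h2 : h <= 2^-1 by rewrite !ge_min lexx.
have hs : h <= s / 2 by rewrite !ge_min lexx orbT.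
have hK : h * K <= d / 2 * s by rewrite -ler_pdivlMr // !ge_min lexx orbT.
have h1 : h < 1 by apply: le_lt_trans h2 _; rewrite invf_lt1 ?ltr0n // ltr1n.
(* an error [e] of order [h ^+ 2] does not affect the ratio of 1 - q to 1 - q^s as h -> 0 *)
pose q := 1 - h; pose e := h ^+ 2.
have q01 : 0 < q < 1 by rewrite /q subr_gt0 h1 gtrBl h0.
have q0 : 0 < q by case/andP: q01.
have e0 : 0 < e by rewrite exprn_gt0.
have [X X2 hX] := primesum_block hL s0 q01 e0.
have /andP[_ qs] : 1 - s * h / (1 - h) <= q `^ s <= (1 + s * h)^-1.
  by apply: powR_1B_bounds; rewrite // h0.
have sh : 0 < 1 + s * h by rewrite addr_gt0 ?mulr_gt0.
pose al := q `^ s * (1 + e); pose be := (1 + e) / q * (1 - q + 2 * e).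
have al0 : 0 <= al by rewrite mulr_ge0 ?powR_ge0 // addr_ge0 // ltW.
have alU : al <= (1 + e) / (1 + s * h).
  by rewrite /al mulrC ler_wpM2l // addr_ge0 // ltW.
have al1 : al < 1.
  apply: (le_lt_trans alU); rewrite ltr_pdivrMr // mul1r ltrD2l /e expr2 ltr_pM2r //.
  by apply: (le_lt_trans hs); rewrite ltr_pdivrMr // ltr_pMr // ltr1n.
have key : be <= u * (1 - al).
  apply: (@le_trans _ _ (u * (1 - (1 + e) / (1 + s * h)))); last first.
    by rewrite ler_wpM2l ?(ltW u0) // lerD2l lerN2.
  have -> : u * (1 - (1 + e) / (1 + s * h)) = h * (u * (s - h) / (1 + s * h)).
    by rewrite /e; field; rewrite gt_eqF.
  have -> : be = h * ((1 + h ^+ 2) * (1 + 2 * h) / q).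
    by rewrite /be /e /q; field; rewrite gt_eqF.
  rewrite ler_pM2l // ler_pdivrMr // mulrAC ler_pdivlMr //.
  have i1 : 1 + h ^+ 2 <= 1 + h by rewrite lerD2l expr2 ler_piMl // ltW.
  have i2 : (1 + h ^+ 2) * (1 + 2 * h) <= 1 + 5 * h.
    apply: (@le_trans _ _ ((1 + h) * (1 + 2 * h))).
      by rewrite ler_wpM2r // addr_ge0 // mulr_ge0 // ltW.
    have : h * h <= h by rewrite ler_piMl // ltW.
    by lra.
  have i3 : (1 + h ^+ 2) * (1 + 2 * h) * (1 + s * h) <= 1 + (5 + 6 * s) * h.
    apply: (@le_trans _ _ ((1 + 5 * h) * (1 + s * h))); first by rewrite ler_wpM2r // ltW.
    have : s * (h * h) <= s * h by rewrite ler_wpM2l ?(ltW s0) // ler_piMl // ltW.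
    by lra.
  apply: (le_trans i3); have -> : u * (s - h) * q = u * s - h * (u * (1 + s)) + u * h ^+ 2.
    by rewrite /q; ring.
  have : 0 <= u * h ^+ 2 by rewrite mulr_ge0 ?sqr_ge0 // ltW.
  move: hK us; rewrite /K; clear => *; lra.
pose T y := primesum L s y / gauge L s y - u.
have hT y : X / q <= y -> T y <= al * T (q * y).
  move=> hy; have Xqy : X <= q * y by rewrite mulrC -ler_pdivrMr.
  have [b1 _ b3 _] := hX y Xqy.
  have qy2 : 2 <= q * y by apply: le_trans Xqy.
  have qyy : q * y <= y.
    rewrite ler_piMl //; last by case/andP: q01 => _ /ltW.
    by rewrite ltW // -(pmulr_rgt0 _ q0) (lt_le_trans _ qy2).
  have g0 := gauge_gt0 s hL qy2; have g1 := gauge_gt0 s hL (le_trans qy2 qyy).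
  have w0 := primesum_ge0 s (q * y) hL.
  rewrite /T lerBlDr ler_pdivrMr //.
  have i1 : primesum L s (q * y) <= al * (primesum L s (q * y) / gauge L s (q * y)) * gauge L s y.
    have E : primesum L s (q * y) = primesum L s (q * y) / gauge L s (q * y) * gauge L s (q * y).
      by rewrite divfK // gt_eqF.
    rewrite [leLHS]E -[leRHS]mulrA [leRHS]mulrCA ler_wpM2l // divr_ge0 // (ltW g0) //.
  have i2 : be * gauge L s y <= u * (1 - al) * gauge L s y by rewrite ler_wpM2r // ltW.
  move: b1 i1 i2; rewrite -/be; set w := primesum L s (q * y); set r := w / _.
  by clear => *; lra.
(* On the starting interval t is bounded by monotonicity of [primesum] and by gauge(y) >= L(y)/ln y
   >= (L(Y0)/ln Y0)/2. *)
have [X3 X32 hX3] := slowly_varying_div_ln_uniform hL q^-1 (ltr01 : 0 < 1 :> R).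
pose Z := Num.max X X3; pose Y0 := Z / q / q.
have Z2 : 2 <= Z by rewrite le_max X2.
have Z0 : 0 < Z by apply: lt_le_trans Z2.
have ZZ : Z <= Z / q by rewrite ler_pdivlMr // ler_piMr ?(ltW Z0) //; case/andP: q01 => _ /ltW.
have ZY : Z / q <= Y0 by rewrite /Y0 ler_wpM2r ?invr_ge0 ?(ltW q0).
have Y02 : 2 <= Y0 by rewrite (le_trans Z2) // (le_trans ZZ).
have lY0 : 0 < L Y0 / ln Y0.
  have [Lpos _ _] := hL; rewrite divr_gt0 ?Lpos // ln_gt0 // (lt_le_trans _ Y02) // ltr1n //.
have bd y : q * Y0 <= y <= Y0 -> T y <= primesum L s Y0 / (L Y0 / ln Y0 / 2).
  move=> /andP[y1 y2].
  have y3 : Z <= y by apply: le_trans y1; rewrite /Y0 mulrC divfK // gt_eqF.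
  have yX3 : X3 <= y by apply: le_trans y3; rewrite le_max lexx orbT.
  have y22 := le_trans Z2 y3.
  have yY : y <= Y0 <= q^-1 * y by rewrite y2 /= mulrC ler_pdivlMr // mulrC.
  have [_ h3] := hX3 y Y0 yX3 yY.
  rewrite /T lerBlDr ler_wpDr ?(ltW u0) //.
  have w0 := primesum_ge0 s y hL; have w1 := primesum_le s hL y2.
  apply: ler_pM => //; first by rewrite invr_ge0 ltW // gauge_gt0.
  rewrite lef_pV2 ?posrE ?gauge_gt0 ?(divr_gt0 lY0) //.
  have y1' : 1 <= y by rewrite (le_trans _ y22) // ler1n.
  have ly : 0 <= L y / ln y.
    by have := gauge_gt0 0 hL y22; rewrite /gauge powRr0 mul1r => /ltW.
  apply: (@le_trans _ _ (L y / ln y)); first by rewrite ler_pdivrMr // [leRHS]mulrC.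
  by rewrite /gauge ler_peMl // -(powRr0 y) ler_powR // ltW.
have hT' y : Y0 <= y -> T y <= al * T (q * y).
  move=> hy; apply: hT; apply: le_trans hy; apply: le_trans ZY.
  by rewrite ler_wpM2r ?invr_ge0 ?(ltW q0) // le_max lexx.
have Y00 : 0 < Y0 by apply: lt_le_trans Y02.
have al01 : 0 <= al < 1 by rewrite al0.
have d20 : 0 < d / 2 by rewrite divr_gt0.
have [Y hY] := contraction_small q01 al01 Y00 hT' bd d20.
exists (Num.max 2 Y); first by rewrite le_max lexx.
move=> y; rewrite ge_max => /andP[y2 /hY].
rewrite /T lerBlDr ler_pdivrMr ?gauge_gt0 // /u addrC -addrA -splitr.
by [].
Qed.

(** The same contraction for c - t with c slightly below 1/s; if c <= 0 the claim is trivial, and on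
    the starting interval c - t <= c. *)
Lemma primesum_lower (R : realType) (L : R -> R) (s d : R) :
  slowly_varying L -> 0 < s -> 0 < d ->
  exists2 X, 2 <= X & forall y, X <= y -> (s^-1 - d) * gauge L s y <= primesum L s y.
Proof.
move=> hL s0 d0; pose c := s^-1 - d / 2.
have [c0|c0] := leP c 0.
  exists 2 => // y y2; apply: (@le_trans _ _ 0); last exact: primesum_ge0.
  rewrite mulr_le0_ge0 ?(ltW (gauge_gt0 _ _ _)) // (le_trans _ c0) // lerD2l lerN2.
  by rewrite ler_pdivrMr // ler_pMr // ler1n.
have cs : c * s = 1 - d / 2 * s by rewrite /c mulrBl mulVf ?gt_eqF.
(* Again the coefficient of h in [key]; h <= 1/4 keeps c + h - 2 h^2 nonnegative there. *)
pose K := 3 + s + c.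
have K0 : 0 < K by rewrite /K; clear - s0 c0; lra.
pose h := Num.min 4^-1 (d / 2 * s / K).
have h0 : 0 < h by rewrite lt_min invr_gt0 ltr0n !divr_gt0 ?mulr_gt0 // divr_gt0.
have h4 : h <= 4^-1 by rewrite ge_min lexx.
have hK : h * K <= d / 2 * s by rewrite -ler_pdivlMr // ge_min lexx orbT.
have h1 : h < 1 by apply: le_lt_trans h4 _; rewrite invf_lt1 ?ltr0n // ltr1n.
pose q := 1 - h; pose e := h ^+ 2.
have q01 : 0 < q < 1 by rewrite /q subr_gt0 h1 gtrBl h0.
have q0 : 0 < q by case/andP: q01.
have e0 : 0 < e by rewrite exprn_gt0.
have [X X2 hX] := primesum_block hL s0 q01 e0.
have h01 : 0 < h < 1 by rewrite h0.
have /andP[qs qs'] := powR_1B_bounds s0 h01.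
have sh : 0 < s * h by rewrite mulr_gt0.
pose al := q `^ s / (1 + e).
have e1 : 0 < 1 + e by rewrite addr_gt0.
have al0 : 0 <= al by rewrite divr_ge0 ?powR_ge0 // ltW.
have al1 : al < 1.
  rewrite /al ltr_pdivrMr // mul1r (le_lt_trans qs') // (@lt_trans _ _ 1) ?ltrDl //.
  by rewrite invf_lt1 ?ltrDl // addr_gt0.
have key : c <= al * (c + h - 2 * e).
  have cp : 0 <= c + h - 2 * e.
    have : h * h <= 4^-1 * h by rewrite ler_wpM2r // ltW.
    by rewrite /e expr2; clear - h0 c0; lra.
  apply: (@le_trans _ _ ((1 - s * h / (1 - h)) / (1 + e) * (c + h - 2 * e))); last first.
    by rewrite ler_wpM2r // /al ler_wpM2r // invr_ge0 ltW.
  rewrite mulrAC ler_pdivlMr // -(ler_pM2l q0).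
  rewrite [leRHS](_ : _ = (1 - (1 + s) * h) * (c + h - 2 * e)); last first.
    by rewrite /q; field; rewrite gt_eqF // -/q.
  rewrite -subr_ge0.
  rewrite (_ : _ - _ = h * ((1 - (1 + s) * h) * (1 - 2 * h) - c * s - c * h + c * h ^+ 2)); last first.
    by rewrite /q /e; ring.
  rewrite mulr_ge0 ?(ltW h0) //.
  have k1 : 0 <= c * h ^+ 2 by rewrite mulr_ge0 ?sqr_ge0 // ltW.
  have k2 : 0 <= (1 + s) * h ^+ 2 by rewrite mulr_ge0 ?sqr_ge0 // ltW // addr_gt0.
  move: hK cs k1 k2; rewrite /K; clear => *; lra.
pose T y := c - primesum L s y / gauge L s y.
have hT y : X / q <= y -> T y <= al * T (q * y).
  move=> hy; have Xqy : X <= q * y by rewrite mulrC -ler_pdivrMr.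
  have [_ b1 _ b3] := hX y Xqy.
  have qy2 : 2 <= q * y by apply: le_trans Xqy.
  have qyy : q * y <= y.
    rewrite ler_piMl //; last by case/andP: q01 => _ /ltW.
    by rewrite ltW // -(pmulr_rgt0 _ q0) (lt_le_trans _ qy2).
  have g0 := gauge_gt0 s hL qy2; have g1 := gauge_gt0 s hL (le_trans qy2 qyy).
  have w0 := primesum_ge0 s (q * y) hL.
  have i1 : al * (primesum L s (q * y) / gauge L s (q * y)) * gauge L s y <= primesum L s (q * y).
    have E : primesum L s (q * y) = primesum L s (q * y) / gauge L s (q * y) * gauge L s (q * y).
      by rewrite divfK // gt_eqF.
    by rewrite [leRHS]E -[leLHS]mulrA [leLHS]mulrCA ler_wpM2l // divr_ge0 // (ltW g0).
  have i2 : c * gauge L s y <= al * (c + h - 2 * e) * gauge L s y by rewrite ler_wpM2r // ltW.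
  have i3 : primesum L s y = primesum L s y / gauge L s y * gauge L s y.
    by rewrite divfK // gt_eqF.
  rewrite -(ler_pM2r g1) /T mulrBl -i3.
  move: b1 i1 i2; rewrite -/al /q; clear - al; lra.
pose Y0 := X / q.
have Y00 : 0 < Y0 by rewrite divr_gt0 // (lt_le_trans _ X2).
have bd y : q * Y0 <= y <= Y0 -> T y <= c.
  move=> /andP[y1 _]; rewrite /T gerBl divr_ge0 ?primesum_ge0 // ltW // gauge_gt0 //.
  by rewrite (le_trans X2) // (le_trans _ y1) // /Y0 mulrC divfK // gt_eqF.
have al01 : 0 <= al < 1 by rewrite al0.
have d20 : 0 < d / 2 by rewrite divr_gt0.
have [Y hY] := contraction_small q01 al01 Y00 hT bd d20.
exists (Num.max 2 Y); first by rewrite le_max lexx.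
move=> y; rewrite ge_max => /andP[y2 /hY].
rewrite /T lerBlDr addrC -lerBlDr ler_pdivlMr ?gauge_gt0 // /c -addrA -opprD -splitr.
by [].
Qed.

(** * The summatory function of F *)

Lemma logn_fact_sum (p N : nat) :
  logn p N`! = (\sum_(1 <= n < N.+1) logn p n)%N.
Proof.
elim: N => [|N IH]; first by rewrite big_geq // logn1.
by rewrite factS lognM ?fact_gt0 // big_nat_recr //= IH addnC.
Qed.

Lemma F_logn (R : realType) (rho : R) (L : R -> R) (n : nat) : (0 < n)%N ->
  F rho L n = \sum_(1 <= p < n.+1 | prime p) (logn p n)%:R * h rho L p.
Proof.
move=> n0; apply: eq_bigr => p pp.
rewrite (eq_bigl (fun a => a == logn p n)); last first.
  by move=> a; rewrite /exactly_divides !pfactor_dvdn // -ltnNge ltnS -eqn_leq.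
rewrite big_nat1_eq; case: ifP => //.
have -> : (logn p n < n.+1)%N.
  rewrite ltnS (leq_trans (ltnW (ltn_expl _ (prime_gt1 pp)))) // dvdn_leq // pfactor_dvdnn //.
by rewrite andbT lt0n => /negbFE /eqP ->; rewrite mul0r.
Qed.

(** F is completely additive, so the sum over n <= N is F at N!, where Legendre's formula
    applies. *)
Lemma sum_F (R : realType) (rho : R) (L : R -> R) (N : nat) :
  \sum_(1 <= n < N.+1) F rho L n =
  \sum_(1 <= p < N.+1 | prime p) (logn p N`!)%:R * h rho L p.
Proof.
transitivity (\sum_(1 <= n < N.+1) \sum_(1 <= p < N.+1 | prime p) (logn p n)%:R * h rho L p).
  rewrite big_nat [RHS]big_nat; apply: eq_bigr => n /andP[n0 nN]; rewrite F_logn //.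
  rewrite [RHS](big_cat_nat (n := n.+1)) //=.
  rewrite [X in _ + X]big_nat_cond [X in _ + X]big1 ?addr0 // => p /andP[/andP[h1 _] pp].
  have -> : logn p n = 0%N; last by rewrite mul0r.
  apply/eqP; rewrite -leqn0 leqNgt -pfactor_dvdn // expn1.
  by apply/negP => /(dvdn_leq n0); rewrite leqNgt h1.
rewrite (exchange_big_dep_nat (fun p => prime p)) //=; apply: eq_bigr => p pp.
by rewrite (eq_bigl xpredT) => [|n]; rewrite ?pp // -mulr_suml logn_fact_sum -natr_sum.
Qed.

Lemma logn_fact_ge (p N : nat) : prime p -> (0 < N)%N -> (N %/ p <= logn p N`!)%N.
Proof. by move=> pp N0; rewrite logn_fact // big_ltn // expn1 leq_addr. Qed.

Lemma logn_fact_eq (p N : nat) : prime p -> (0 < N)%N -> (N < p ^ 2)%N ->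
  logn p N`! = (N %/ p)%N.
Proof.
move=> pp N0 h; rewrite logn_fact // big_ltn // expn1 big_nat big1 ?addn0 // => k /andP[k2 _].
by rewrite divn_small // (leq_trans h) // leq_pexp2l // prime_gt0.
Qed.

Lemma sum_geometric_le (R : realType) (x : R) (K : nat) : 0 <= x <= 2^-1 ->
  \sum_(1 <= k < K.+1) x ^+ k <= 2 * x.
Proof.
move=> /andP[x0 x2].
(* The subtracted x^K carries the induction; its factor removes it at K = 0, where 2 x - 1 could be
   negative. *)
suff h : \sum_(1 <= k < K.+1) x ^+ k <= 2 * x - x ^+ K * (0 < K)%N%:R.
  by apply: (le_trans h); rewrite gerBl mulr_ge0 ?exprn_ge0.
elim: K => [|[|K] IH]; first by rewrite big_geq // mulr0 subr0 mulr_ge0.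
  by rewrite big_nat1 expr1 mulr1; lra.
rewrite big_nat_recr //=; have := IH; rewrite !mulr1 => {}IH.
have : 2 * x ^+ K.+2 <= x ^+ K.+1.
  by rewrite exprS mulrA ler_piMl ?exprn_ge0 // mulrC -ler_pdivlMr // mul1r.
by move: IH; move: (\sum_(_ <= _ < _) _) (x ^+ K.+2) (x ^+ K.+1) => *; lra.
Qed.

Lemma logn_fact_le (R : realType) (p N : nat) : prime p ->
  (logn p N`!)%:R <= 2 * (N%:R / p%:R) :> R.
Proof.
move=> pp; have p0 := prime_gt0 pp; rewrite logn_fact // natr_sum.
apply: (@le_trans _ _ (\sum_(1 <= k < N.+1) N%:R * (p%:R^-1) ^+ k)).
  by apply: ler_sum => k _; rewrite exprVn -natrX; exact: natr_divn_le.
rewrite -mulr_sumr mulrCA ler_wpM2l // sum_geometric_le // invr_ge0 ler0n /=.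
by rewrite lef_pV2 ?posrE ?ltr0n // ler_nat prime_gt1.
Qed.

Lemma truncn_divn (R : realType) (x : R) (m : nat) : 0 <= x -> (0 < m)%N ->
  Num.truncn (x / m%:R) = (Num.truncn x %/ m)%N.
Proof.
move=> x0 m0; have mR : 0 < m%:R :> R by rewrite ltr0n.
have /andP[h1 h2] := truncn_itv x0.
apply: truncn_def; rewrite ler_pdivlMr // ltr_pdivrMr // -!natrM; apply/andP; split.
  by rewrite (le_trans _ h1) // ler_nat leq_trunc_div.
by rewrite (lt_le_trans h2) // ler_nat ltn_ceil.
Qed.

Lemma h_powR (R : realType) (rho : R) (L : R -> R) (p : nat) : (0 < p)%N ->
  h rho L p = p%:R `^ (rho + 1) / p%:R * L p%:R.
Proof.
move=> p0; rewrite /h powRD; last by rewrite pnatr_eq0 -lt0n p0 implybT.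
by rewrite powRr1 // mulfK // pnatr_eq0 -lt0n.
Qed.

(** The prime p is counted once for each m <= M with p m <= x: Legendre's leading term [x/p], cut
    off at M. *)
Lemma sum_primesum (R : realType) (rho : R) (L : R -> R) (x : R) (M : nat) : 0 <= x ->
  \sum_(1 <= m < M.+1) primesum L (rho + 1) (x / m%:R) =
  \sum_(1 <= p < (Num.truncn x).+1 | prime p)
    (minn M (Num.truncn x %/ p))%:R * h rho L p.
Proof.
move=> x0; set N := Num.truncn x.
transitivity (\sum_(1 <= m < M.+1) \sum_(1 <= p < N.+1 | prime p && (p * m <= N)%N) h rho L p).
  rewrite big_nat [RHS]big_nat; apply: eq_bigr => m /andP[m0 _].
  rewrite /primesum truncn_divn // -/N.
  rewrite [RHS](big_cat_nat (n := (N %/ m).+1)) //=; last by rewrite ltnS leq_div.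
  rewrite [X in _ = _ + X]big_nat_cond [X in _ = _ + X]big1 ?addr0; last first.
    by move=> p /andP[/andP[h1 _] /andP[_ h2]]; move: h1; rewrite ltnNge leq_divRL // h2.
  rewrite big_nat_cond [RHS]big_nat_cond; apply: eq_big => p.
    by case: (boolP (0 < p < _)%N) => //= /andP[_]; rewrite ltnS leq_divRL // => ->; rewrite andbT.
  by move=> /andP[/andP[p0 _] _]; rewrite h_powR.
rewrite (exchange_big_dep_nat (fun p => prime p)) //=; last by move=> m p _ _ _ /andP[].
apply: eq_bigr => p pp; have p0 := prime_gt0 pp.
rewrite mulr_natl -(@sum_nat_const_le _ M (minn M (N %/ p))); last exact: geq_minl.
rewrite big_nat_cond [RHS]big_nat_cond; apply: eq_bigl => m; rewrite pp /=.
case: (boolP (0 < m < M.+1)%N) => //= /andP[_]; rewrite ltnS => mM.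
by rewrite leq_min mM /= leq_divRL // mulnC.
Qed.

Lemma sum_F_lower (R : realType) (rho : R) (L : R -> R) (x : R) (M : nat) :
  slowly_varying L -> 1 <= x ->
  \sum_(1 <= m < M.+1) primesum L (rho + 1) (x / m%:R) <=
  \sum_(1 <= n < (Num.truncn x).+1) F rho L n.
Proof.
move=> hL x1; rewrite sum_primesum ?(le_trans ler01) // sum_F.
apply: ler_sum => p pp; have p0 := prime_gt0 pp.
rewrite ler_wpM2r //; first by rewrite h_powR //; exact: primesum_term_ge0.
by rewrite ler_nat (leq_trans (geq_minr _ _)) // logn_fact_ge // truncn_gt0.
Qed.

(* The primes p > x/M satisfy p^2 > x, so their higher powers do not occur. *)
Lemma sum_F_upper (R : realType) (rho : R) (L : R -> R) (x : R) (M : nat) :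
  slowly_varying L -> (0 < M)%N -> (M ^ 2)%:R <= x ->
  \sum_(1 <= n < (Num.truncn x).+1) F rho L n <=
  \sum_(1 <= m < M.+1) primesum L (rho + 1) (x / m%:R) +
    2 * x * primesum L rho (x / M%:R).
Proof.
move=> hL M0 xM; have x1 : 1 <= x by rewrite (le_trans _ xM) // ler1n expn_gt0 M0.
have x0 : 0 <= x by apply: le_trans x1.
rewrite sum_primesum // sum_F /primesum truncn_divn //; set N := Num.truncn x.
have N0 : (0 < N)%N by rewrite truncn_gt0.
have NM : (M ^ 2 <= N)%N by rewrite truncn_ge_nat.
have Nx : N%:R <= x by rewrite truncn_le.
have -> : 2 * x * \sum_(1 <= p < (N %/ M).+1 | prime p) p%:R `^ rho / p%:R * L p%:R =
   \sum_(1 <= p < N.+1 | prime p)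
     (if (p <= N %/ M)%N then 2 * x * (p%:R `^ rho / p%:R * L p%:R) else 0).
  rewrite mulr_sumr [RHS](big_cat_nat (n := (N %/ M).+1)) //=; last by rewrite ltnS leq_div.
  rewrite [X in _ = _ + X]big_nat_cond [X in _ = _ + X]big1 ?addr0; last first.
    by move=> p /andP[/andP[h1 _] _]; rewrite leqNgt h1.
  rewrite big_nat_cond [RHS]big_nat_cond; apply: eq_bigr => p /andP[/andP[_ h1] _].
  by rewrite -ltnS h1.
rewrite -big_split /=; apply: ler_sum => p pp; have p0 := prime_gt0 pp.
have h0 : 0 <= h rho L p by rewrite h_powR //; exact: primesum_term_ge0.
case: leqP => hp.
  apply: (@le_trans _ _ (2 * x * (p%:R `^ rho / p%:R * L p%:R))).
    have -> : 2 * x * (p%:R `^ rho / p%:R * L p%:R) = 2 * (x / p%:R) * h rho L p.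
      by rewrite /h; ring.
    rewrite ler_wpM2r // (le_trans (logn_fact_le R N pp)) // ler_wpM2l // ler_wpM2r //.
  by rewrite lerDr mulr_ge0.
rewrite addr0 ler_wpM2r // ler_nat.
(* From p M > N >= M^2 follows p > M, hence p^2 > N and [N/p] <= M. *)
have NpM : (N < p * M)%N by rewrite -ltn_divLR.
have Mp : (M < p)%N by rewrite -(ltn_pmul2r M0) (leq_ltn_trans _ NpM) // mulnn.
rewrite logn_fact_eq //; last by rewrite (ltn_trans NpM) // -mulnn ltn_pmul2l.
by rewrite leq_min leqnn andbT -ltnS ltn_divLR // (leq_trans NpM) // mulnC leq_mul2r leqnSn orbT.
Qed.

(** [powR_1B_bounds] at h = 1/(n + 1) replaces the comparison with an integral. *)
Lemma powR_telescope (R : realType) (rho : R) (n : nat) : 0 < rho -> (0 < n)%N ->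
  rho * (n.+1%:R `^ (rho + 1))^-1 <= (n%:R `^ rho)^-1 - (n.+1%:R `^ rho)^-1.
Proof.
move=> r0 n0; set a : R := n.+1%:R; have a0 : 0 < a by rewrite ltr0n.
have a1 : 0 < a^-1 < 1 by rewrite invr_gt0 a0 invf_lt1 // ltr1n ltnS n0.
have /andP[_ hq] := powR_1B_bounds r0 a1.
have En : n%:R = a * (1 - a^-1) :> R.
  by rewrite mulrBr mulr1 divff ?gt_eqF // /a -natr1 addrK.
have q0 : 0 < 1 - a^-1 by case/andP: a1 => *; rewrite subr_gt0.
rewrite En powRM ?(ltW a0) ?(ltW q0) // powRD; last by rewrite (gt_eqF a0) implybT.
rewrite powRr1 ?(ltW a0) // !invfM.
have Q0 : 0 < (1 - a^-1) `^ rho by rewrite powR_gt0.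
have A0 : 0 <= (a `^ rho)^-1 by rewrite invr_ge0 powR_ge0.
have h : 1 + rho * a^-1 <= ((1 - a^-1) `^ rho)^-1.
  by rewrite -[leLHS]invrK lef_pV2 ?posrE // invr_gt0 addr_gt0 // mulr_gt0 // invr_gt0.
have := ler_wpM2l A0 h; set A := (a `^ rho)^-1; set Q := ((1 - a^-1) `^ rho)^-1.
by move: A Q (a^-1) {A0 Q0 h hq q0 En a1} => *; lra.
Qed.

Lemma zeta_partial_bounds (R : realType) (rho : R) : 0 < rho ->
  (forall M, series (fun n : nat => (n.+1%:R `^ (rho + 1))^-1) M <= zeta (rho + 1)) /\
  (forall e, 0 < e -> exists M0, forall M, (M0 <= M)%N ->
     zeta (rho + 1) - e <= series (fun n : nat => (n.+1%:R `^ (rho + 1))^-1) M).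
Proof.
move=> r0; set u := fun n : nat => (n.+1%:R `^ (rho + 1))^-1.
have u0 n : 0 <= u n by rewrite invr_ge0 powR_ge0.
have nd : nondecreasing_seq (series u).
  by apply/nondecreasing_seqP => n; rewrite seriesSr lerDl.
have bd M : series u M.+1 <= 1 + rho^-1 * (1 - (M.+1%:R `^ rho)^-1).
  elim: M => [|M IH].
    by rewrite seriesSr /series /= big_geq // add0r /u !powR1 invr1 subrr mulr0 addr0.
  rewrite seriesSr; apply: (le_trans (lerD IH (lexx _))).
  have := @powR_telescope R rho M.+1 r0 isT; rewrite -/(u M.+1).
  rewrite -ler_pdivlMl //; move: (u _) (_^-1) (_ `^ rho)^-1 => *; lra.
have cv : cvgn (series u).
  apply: nondecreasing_is_cvgn => //; exists (1 + rho^-1) => _ [M _ <-].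
  apply: (@le_trans _ _ (series u M.+1)); first exact: nd.
  have h : 1 - (M.+1%:R `^ rho)^-1 <= 1 :> R by rewrite gerBl invr_ge0 powR_ge0.
  apply: (le_trans (bd M)); rewrite lerD2l ler_piMr // invr_ge0 (ltW r0) //.
split; first by move=> M; exact: nondecreasing_cvgn_le.
move=> e e0; have /cvgr_dist_le /(_ e e0) [M0 _ hM] := cv.
exists M0 => M /hM /=; rewrite ler_norml => /andP[_].
by rewrite lerBlDr lerBlDl addrC.
Qed.

Lemma gauge_dilation (R : realType) (L : R -> R) (s x : R) (m : nat) (d : R) :
  0 < s -> 0 < d -> (0 < m)%N -> 0 < x ->
  L (x / m%:R) / ln (x / m%:R) <= (1 + d) * (L x / ln x) ->
  L x / ln x <= (1 + d) * (L (x / m%:R) / ln (x / m%:R)) ->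
  gauge L s (x / m%:R) <= (m%:R `^ s)^-1 * ((1 + d) * gauge L s x) /\
  (m%:R `^ s)^-1 * (gauge L s x / (1 + d)) <= gauge L s (x / m%:R).
Proof.
move=> s0 d0 m0 x0 h1 h2; have mR : 0 < m%:R :> R by rewrite ltr0n.
have -> : gauge L s (x / m%:R) = (m%:R `^ s)^-1 * x `^ s * (L (x / m%:R) / ln (x / m%:R)).
  rewrite /gauge powRM ?invr_ge0 ?(ltW x0) ?(ltW mR) //.
  have -> : m%:R^-1 `^ s = (m%:R `^ s)^-1.
    have ms : m%:R `^ s != 0 by rewrite gt_eqF // powR_gt0.
    apply: (mulIf ms); rewrite -powRM ?invr_ge0 // ?(ltW mR) //.
    by rewrite !mulVf ?powR1 // gt_eqF.
  by rewrite [x `^ s * _]mulrC.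
have c0 : 0 <= (m%:R `^ s)^-1 * x `^ s by rewrite mulr_ge0 ?invr_ge0 ?powR_ge0.
have d1 : 0 < 1 + d by rewrite addr_gt0.
split.
  rewrite [leRHS](_ : _ = (m%:R `^ s)^-1 * x `^ s * ((1 + d) * (L x / ln x))); last first.
    by rewrite /gauge; ring.
  by rewrite ler_wpM2l.
rewrite [leLHS](_ : _ = (m%:R `^ s)^-1 * x `^ s * ((1 + d)^-1 * (L x / ln x))); last first.
  by rewrite /gauge; ring.
by rewrite ler_wpM2l // ler_pdivrMl.
Qed.

Lemma sum_F_asymptotic (R : realType) (rho : R) (L : R -> R) (e : R) :
  0 < rho -> slowly_varying L -> 0 < e ->
  exists2 X, 2 <= X & forall x, X <= x ->
   (zeta (rho + 1) / (rho + 1) - e) * gauge L (rho + 1) x <=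
   \sum_(1 <= n < (Num.truncn x).+1) F rho L n <=
   (zeta (rho + 1) / (rho + 1) + e) * gauge L (rho + 1) x.
Proof.
move=> r0 hL e0'; pose s := rho + 1; pose e2 := e / 2.
have e0 : 0 < e2 by rewrite divr_gt0.
have s0 : 0 < s by rewrite addr_gt0.
have s1 : 1 <= s by rewrite lerDr ltW.
have si : s^-1 <= 1 by rewrite invf_le1.
have si0 : 0 < s^-1 by rewrite invr_gt0.
pose z := zeta s.
have [zle zge] := zeta_partial_bounds r0; rewrite -/s -/z in zle zge.
have z0 : 0 <= z by have := zle 0%N; rewrite /series /= big_geq.
(* d <= 1/s keeps 1/s - d nonnegative; the other bound gives 3 d zeta(s) <= e/2, and the summand 1
   avoids dividing by 0. *)
pose d := Num.min s^-1 (e2 / (3 * z + 1)).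
have d0 : 0 < d by rewrite lt_min si0 divr_gt0 // ltr_wpDl // mulr_ge0.
have ds : d <= s^-1 by rewrite ge_min lexx.
have dz : 3 * d * z <= e2.
  have : d * (3 * z + 1) <= e2.
    by rewrite -ler_pdivlMr ?ge_min ?lexx ?orbT // ltr_wpDl // mulr_ge0.
  by clear - d0; lra.
have [M0 hM0] := zge e2 e0.
(* 2 from [sum_F_upper], 1/rho + 1 from [primesum_upper] with error 1, and 2 from 1 + d <= 2. M is
   chosen so that B M^(-rho) <= e/2. *)
pose B := 4 * (rho^-1 + 1).
have B0 : 0 < B by rewrite mulr_gt0 // addr_gt0 // invr_gt0.
pose M := maxn 1 (maxn M0 (Num.truncn ((B / e2) `^ rho^-1)).+1).
have M1 : (0 < M)%N by rewrite leq_max.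
have MR : 0 < M%:R :> R by rewrite ltr0n.
pose Z := series (fun n : nat => (n.+1%:R `^ s)^-1 : R) M.
have Zz : Z <= z := zle M.
have zZ : z - e2 <= Z by apply: hM0; rewrite !leq_max leqnn orbT.
have Z0 : 0 <= Z by apply: sumr_ge0 => n _; rewrite invr_ge0 powR_ge0.
have BM : B * (M%:R `^ rho)^-1 <= e2.
  rewrite ler_pdivrMr ?powR_gt0 // mulrC -ler_pdivrMr //.
  have be0 : 0 <= B / e2 by rewrite divr_ge0 // ltW.
  have E : B / e2 = ((B / e2) `^ rho^-1) `^ rho by rewrite -powRrM mulVf ?gt_eqF // powRr1.
  rewrite [leLHS]E ge0_ler_powR ?nnegrE ?powR_ge0 ?(ltW r0) ?(ltW MR) //.
  by rewrite (le_trans (ltW (truncnS_gt _))) // ler_nat !leq_max leqnn !orbT.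
have [X1 X12 hX1] := slowly_varying_div_ln_uniform hL M%:R d0.
have [X2 X22 hX2] := primesum_upper hL s0 d0.
have [X3 X32 hX3] := primesum_lower hL s0 d0.
have [X4 X42 hX4] := primesum_upper hL r0 ltr01.
pose X := Num.max (Num.max X1 X2) (Num.max X3 X4).
have X2' : 2 <= X by rewrite !le_max X12.
have X0 : 0 < X by apply: lt_le_trans X2'.
(* The factor M makes all estimates available at x/m for every m <= M. *)
exists (Num.max (X * M%:R) (M ^ 2)%:R).
  by rewrite le_max (le_trans X2') // ler_peMr ?(ltW X0) // ler1n.
move=> x; rewrite ge_max => /andP[xX xM].
have xm m : (0 < m <= M)%N -> X <= x / m%:R.
  move=> /andP[m0 mM]; rewrite ler_pdivlMr ?ltr0n // (le_trans _ xX) //.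
  by rewrite ler_wpM2l ?(ltW X0) // ler_nat.
have xX' : X <= x by have := xm 1%N; rewrite M1 divr1 => /(_ isT).
have x0 : 0 < x by apply: lt_le_trans xX'.
have x2 : 2 <= x by apply: le_trans xX'.
have g0 := gauge_gt0 s hL x2.
have Xs y : X <= y -> [/\ X1 <= y, X2 <= y, X3 <= y & X4 <= y].
  by rewrite !ge_max => /andP[/andP[-> ->] /andP[-> ->]].
have dil t m : 0 < t -> (0 < m <= M)%N ->
    gauge L t (x / m%:R) <= (m%:R `^ t)^-1 * ((1 + d) * gauge L t x) /\
    (m%:R `^ t)^-1 * (gauge L t x / (1 + d)) <= gauge L t (x / m%:R).
  move=> t0 hm; have [y1 _ _ _] := Xs _ (xm m hm); have /andP[m0 mM] := hm.
  have mR : 0 < m%:R :> R by rewrite ltr0n.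
  have hxy : x / m%:R <= x <= M%:R * (x / m%:R).
    rewrite ler_piMr ?(ltW x0) ?invf_le1 // ?ler1n // mulrCA ler_peMr ?(ltW x0) //.
    by rewrite ler_pdivlMr // mul1r ler_nat.
  by have [h1 h2] := hX1 _ _ y1 hxy; apply: gauge_dilation.
have ZE : Z = \sum_(1 <= m < M.+1) (m%:R `^ s)^-1 by rewrite big_add1.
have d1 : 0 < 1 + d by rewrite addr_gt0.
have up : \sum_(1 <= m < M.+1) primesum L s (x / m%:R) <= (s^-1 + d) * (1 + d) * Z * gauge L s x.
  rewrite ZE mulr_sumr mulr_suml big_nat [leRHS]big_nat; apply: ler_sum => m hm.
  have [_ y2 _ _] := Xs _ (xm m hm); have [h _] := dil s m s0 hm.
  apply: (le_trans (hX2 _ y2)); rewrite -!mulrA ler_wpM2l ?addr_ge0 ?(ltW si0) ?(ltW d0) //.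
  by rewrite [leRHS]mulrCA.
have lo : (s^-1 - d) / (1 + d) * Z * gauge L s x <= \sum_(1 <= m < M.+1) primesum L s (x / m%:R).
  rewrite ZE mulr_sumr mulr_suml big_nat [leRHS]big_nat; apply: ler_sum => m hm.
  have [_ _ y3 _] := Xs _ (xm m hm); have [_ h] := dil s m s0 hm.
  apply: (le_trans _ (hX3 _ y3)); rewrite -!mulrA ler_wpM2l ?subr_ge0 //.
  by rewrite [leLHS]mulrCA [(1 + d)^-1 * _]mulrC.
have hMM : (0 < M <= M)%N by rewrite M1 leqnn.
have d11 : d <= 1 by apply: le_trans si.
have tail : 2 * x * primesum L rho (x / M%:R) <= e2 * gauge L s x.
  have [_ _ _ y4] := Xs _ (xm M hMM); have [h _] := dil rho M r0 hMM.
  have k0 : 0 < rho^-1 + 1 by rewrite addr_gt0 // invr_gt0.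
  have gE : gauge L s x = x * gauge L rho x.
    rewrite /gauge powRD; last by rewrite (gt_eqF x0) implybT.
    by rewrite powRr1 ?(ltW x0) //; ring.
  have gr := gauge_gt0 rho hL x2.
  apply: (@le_trans _ _ (2 * x * ((rho^-1 + 1) * ((M%:R `^ rho)^-1 * (2 * gauge L rho x))))).
    rewrite ler_wpM2l ?mulr_ge0 ?(ltW x0) // (le_trans (hX4 _ y4)) // ler_wpM2l ?(ltW k0) //.
    rewrite (le_trans h) // ler_wpM2l ?invr_ge0 ?powR_ge0 // ler_wpM2r ?(ltW gr) //.
    by rewrite -[2]/(1 + 1) lerD2l.
  rewrite [leLHS](_ : _ = B * (M%:R `^ rho)^-1 * (x * gauge L rho x)); last by rewrite /B; ring.
  by rewrite -gE ler_wpM2r // ltW.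
have S1 := @sum_F_lower R rho L x M hL (le_trans (ler1n R 2) x2).
have S2 := sum_F_upper rho hL M1 xM.
have c1 : (s^-1 + d) * (1 + d) * Z <= z / s + e2.
  have i1 : (s^-1 + d) * (1 + d) <= s^-1 + 3 * d.
    have : d * d <= d by rewrite ler_piMl // ltW.
    have : s^-1 * d <= d by rewrite ler_piMl // ltW.
    by clear => *; lra.
  apply: (le_trans (ler_pM _ Z0 i1 Zz)).
    by rewrite mulr_ge0 ?(ltW d1) // addr_ge0 ?(ltW d0) // ltW.
  by move: dz; clear => *; lra.
have c2 : z / s - e <= (s^-1 - d) / (1 + d) * Z.
  have i1 : s^-1 - 3 * d <= (s^-1 - d) / (1 + d).
    rewrite ler_pdivlMr //.
    have : 0 <= d * d by rewrite mulr_ge0 // ltW.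
    have : s^-1 * d <= d by rewrite ler_piMl // ltW.
    by move: d0; clear => *; lra.
  apply: (le_trans _ (ler_wpM2r Z0 i1)).
  have i2 : 3 * d * Z <= e2 by apply: le_trans dz; rewrite ler_wpM2l // mulr_ge0 // ltW.
  have i3 : s^-1 * (z - e2) <= s^-1 * Z by rewrite ler_wpM2l // ltW.
  have i4 : s^-1 * e2 <= e2 by rewrite ler_piMl // ltW.
  by move: i2 i3 i4; rewrite /e2; clear => *; lra.
apply/andP; split.
  apply: (le_trans _ S1); apply: (le_trans _ lo).
  by rewrite ler_wpM2r // ltW.
apply: (le_trans S2); apply: (le_trans (lerD up tail)).
rewrite -mulrDl ler_wpM2r ?(ltW g0) //.
by move: c1; rewrite -/s -/z /e2; clear => *; lra.
Qed.

Theorem mainTheorem1 (R : realType) (rho : R) (L : R -> R)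
    (hrho : 0 < rho) (hL : slowly_varying L) :
  exists eps : R -> R,
    eps x @[x --> +oo] --> (0 : R) /\
    forall x : R, 2 <= x ->
      \sum_(1 <= n < (Num.truncn x).+1) F rho L n =
      (zeta (rho + 1) / (rho + 1) + eps x) * (x `^ (rho + 1) * L x / ln x).
Proof.
(* The error is defined by solving the identity for it, which positivity of [gauge] permits for
   every x >= 2. *)
exists (fun x => (\sum_(1 <= n < (Num.truncn x).+1) F rho L n) / gauge L (rho + 1) x
   - zeta (rho + 1) / (rho + 1)); split.
  apply/cvgrPdist_le => e e0; have [X X2 hX] := sum_F_asymptotic hrho hL e0.
  exists X; split; first exact: num_real.
  move=> x /ltW Xx; have /andP[h1 h2] := hX x Xx.
  have g0 := gauge_gt0 (rho + 1) hL (le_trans X2 Xx).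
  rewrite sub0r normrN ler_norml lerBrDr lerBlDr addrC ler_pdivlMr // h1 /=.
  by rewrite ler_pdivrMr // [e + _]addrC.
move=> x x2; have g0 := gauge_gt0 (rho + 1) hL x2.
by rewrite [_ + (_ - _)]addrC subrK -[x `^ _ * L x / ln x]mulrA divfK // gt_eqF.
Qed.
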